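(* Let $(A,L)$ be an extended complete spectral metric space, $\mathbb{F}=(f_1,\ldots,f_k)$ a dual iterated function system on $A$, and $\pi\in\Delta^k$. Suppose $\Lambda^1_L(\pi\cdot\mathbb{F}^* )<1$ and that there exists $\phi_0\in\mathcal{S}(A)$ such that $d_L\big(\phi_0,(\pi\cdot\mathbb{F}^* )(\phi_0)\big)<\infty$. Then there exists at least one $(\pi\cdot\mathbb{F}^* )$-self-similar state. In particular, the sequence $\big((\pi\cdot\mathbb{F}^* )^M(\phi_0)\big)_{M=0}^\infty\subset\mathcal{S}(A)$ is $d_L$-convergent, and its limit is $(\pi\cdot\mathbb{F}^* )$-self-similar. Moreover, the set of all $(\pi\cdot\mathbb{F}^* )$-self-similar states is convex, and if $\phi,\phi'$ are $(\pi\cdot\mathbb{F}^* )$-self-similar states with $d_L(\phi,\phi')<\infty$, then $\phi=\phi'$.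
   Context: Let $A$ be a $C^*$-algebra, $A^{\mathrm{sa}}$ its self-adjoint part, $M(A)$ its multiplier algebra with self-adjoint part $M(A)^{\mathrm{sa}}$, and $\mathcal{S}(A)$, $\mathcal{S}(M(A))$ the state spaces. $\mathcal{S}(A)$ is identified with the set of strictly continuous states of $M(A)$ (via unique strictly continuous extension). An extended complete spectral metric space is a pair $(A,L)$ where $L:A^{\mathrm{sa}}\to[0,\infty]$ is an extended semi-norm such that (1) $\{c\in A^{\mathrm{sa}}: L(c)<\infty\}$ is norm dense in $A^{\mathrm{sa}}$; (2) there is an approximate identity $(I_n)$ of $A$ (a net of positive contractions) with $L(I_n)\to0$; (3) $L$ is norm lower semicontinuous, i.e. $\{b\in A^{\mathrm{sa}}:L(b)\le c\}$ is norm closed for all $c\ge 0$. Put $d_L(\phi,\psi)=\sup\{|\phi(b)-\psi(b)| : b\in A^{\mathrm{sa}},L(b)\le1\}\in[0,\infty]$ for $\phi,\psi\in\mathcal{S}(A)$. Standing assumption: for all $b\in A^{\mathrm{sa}}$, $L(b)=\inf\{C>0: |\phi(b)-\psi(b)|\le C\,d_L(\phi,\psi)\ \forall \phi,\psi\in\mathcal{S}(A)\}$. The same formula extends $L$ to $M(A)^{\mathrm{sa}}$. A $*$-homomorphism $f:A\to M(B)$ is relatively proper if there is an increasing approximate identity $(I_n)$ of $A$ with $f(I_n)\to I\in M(B)$ strictly; such $f$ extends uniquely to a unital $*$-homomorphism $M(A)\to M(B)$ that is strictly continuous on the unit ball, also denoted $f$. A dual iterated function system (dual IFS) on $A$ is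 a finite list $\mathbb{F}=(f_1,\ldots,f_k)$ of relatively proper $*$-homomorphisms $f_i:A\to M(A)$. $\Delta^k=\{(\pi_1,\ldots,\pi_k)\in[0,1]^k:\sum_i\pi_i=1\}$. For $\pi\in\Delta^k$, $(\pi\cdot\mathbb{F}^* )\phi=\sum_{i=1}^k\pi_i\,\phi\circ f_i$; this maps $\mathcal{S}(A)$ to $\mathcal{S}(A)$. A state $\phi\in\mathcal{S}(A)$ is $(\pi\cdot\mathbb{F}^* )$-self-similar if $\phi=(\pi\cdot\mathbb{F}^* )(\phi)$. Dilation factors: $\Lambda_L(f)=\sup\{L(f(b)):b\in A^{\mathrm{sa}},L(b)\le1\}\in[0,\infty]$ and $\Lambda^1_L(\pi\cdot\mathbb{F}^* )=\sum_{i=1}^k\pi_i\Lambda_L(f_i)\in[0,\infty]$ (with $0\cdot\infty=0$ in this sum). *)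

(* Defs.v *)
From HB Require Import structures.
From mathcomp Require Import all_boot all_order all_algebra.
From mathcomp Require Import complex.
From mathcomp Require Import all_classical all_reals.
From mathcomp Require Import ereal topology normedtype sequences.

Set Implicit Arguments.
Unset Strict Implicit.
Unset Printing Implicit Defensive.

Import Order.TTheory GRing.Theory Num.Theory.
Import numFieldNormedType.Exports.

Local Open Scope classical_set_scope.
Local Open Scope ring_scope.
Local Open Scope complex_scope.

Reserved Notation "a ** b" (at level 40, left associativity).

(* C*-algebras are not assumed to be unital, so the product cannot be that of
   a MathComp ring. *)
HB.mixin Record isCStarAlgebra (C : numClosedFieldType) A
    & CompleteNormedModule C A := {
  smul : A -> A -> A ;
  star : A -> A ;
  smulA : associative smul ;
  smulDl : left_distributive smul +%R ;
  smulDr : right_distributive smul +%R ;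
  smulZl : forall (c : C) a b, smul (c *: a) b = c *: smul a b ;
  smulZr : forall (c : C) a b, smul a (c *: b) = c *: smul a b ;
  starK : involutive star ;
  starD : {morph star : a b / a + b} ;
  starZ : forall (c : C) a, star (c *: a) = c^* *: star a ;
  starM : forall a b, star (smul a b) = smul (star b) (star a) ;
  norm_smul_le : forall a b, `|smul a b| <= `|a| * `|b| ;
  norm_star_smul : forall a, `|smul (star a) a| = `|a| ^+ 2
}.

#[short(type="cstarAlgType")]
HB.structure Definition CStarAlgebra (C : numClosedFieldType) :=
  {A of CompleteNormedModule C A & isCStarAlgebra C A}.

Notation "a ** b" := (smul a b) : ring_scope.

Section cstar_theory.
Context (C : numClosedFieldType) (A : cstarAlgType C).
Implicit Types (a b c : A).

Lemma smul0l a : 0 ** a = 0.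
Proof. by have := smulZl 0 a a; rewrite !scale0r. Qed.

Lemma smul0r a : a ** 0 = 0.
Proof. by have := smulZr 0 a a; rewrite !scale0r. Qed.

Lemma smulNl a b : (- a) ** b = - (a ** b).
Proof. by rewrite -scaleN1r smulZl scaleN1r. Qed.

Lemma smulNr a b : a ** (- b) = - (a ** b).
Proof. by rewrite -scaleN1r smulZr scaleN1r. Qed.

Lemma smulBl a b c : (a - b) ** c = a ** c - b ** c.
Proof. by rewrite smulDl smulNl. Qed.

Lemma smulBr a b c : a ** (b - c) = a ** b - a ** c.
Proof. by rewrite smulDr smulNr. Qed.

Lemma star0 : star (0 : A) = 0.
Proof. by have := starZ 0 (0 : A); rewrite conjC0 !scale0r. Qed.

Lemma smul_faithful a b : (forall c, c ** a = c ** b) -> a = b.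
Proof.
move=> h; apply/eqP; rewrite -subr_eq0 -normr_eq0 -sqrf_eq0 -norm_star_smul.
by rewrite smulBr h subrr normr0.
Qed.

Lemma norm_star a : `|star a| = `|a|.
Proof.
have le b : `|b| <= `|star b|.
  have [->|b0] := eqVneq b 0; first by rewrite normr0.
  by rewrite -(ler_pM2r (x := `|b|)) ?normr_gt0// -expr2 -norm_star_smul
     norm_smul_le.
by apply/eqP; rewrite eq_le le -{2}(starK a) le.
Qed.

End cstar_theory.

(* The norm of a normedModType R[i] takes its values in R[i]. *)
Definition normR (R : realType) (V : normedZmodType R[i]) (x : V) : R :=
  complex.Re `|x|.

Section normR_theory.
Context (R : realType) (V : normedZmodType R[i]).
Implicit Types a : V.

Lemma normRE a : (normR a)%:C = `|a|.
Proof. by rewrite /normR RRe_real// normr_real. Qed.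

Lemma normR_ge0 a : 0 <= normR a.
Proof. by rewrite -ler0c normRE. Qed.

End normR_theory.

Section multiplier_algebra.
Context (R : realType) (A : cstarAlgType R[i]).

Definition bounded_linear (T : A -> A) : Prop :=
  linear T /\ exists K : R, forall a, `|T a| <= K%:C * `|a|.

(* M(A) as the algebra of double centralisers (L, R). The identities
   L(ab) = L(a)b and R(ab) = aR(b) follow from centralP: see lmulM, rmulM. *)
Record multiplier := Multiplier {
  lmul : A -> A ;
  rmul : A -> A ;
  lmul_bl : bounded_linear lmul ;
  rmul_bl : bounded_linear rmul ;
  centralP : forall a b, rmul a ** b = a ** lmul b
}.
Implicit Types m n : multiplier.

HB.instance Definition _ := gen_eqMixin multiplier.
HB.instance Definition _ := gen_choiceMixin multiplier.

Lemma multiplier_eq m n : lmul m =1 lmul n -> rmul m =1 rmul n -> m = n.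
Proof.
case: m n => [l r lb rb lr] [l' r' lb' rb' lr'] /= /funext ll' /funext rr'.
by subst l' r'; congr Multiplier; exact: Prop_irrelevance.
Qed.

Lemma multiplier_eql m n : lmul m =1 lmul n -> m = n.
Proof.
move=> h; apply: multiplier_eq => // a.
rewrite -[LHS]starK -[RHS]starK; congr star; apply: smul_faithful => b.
by rewrite -(starK b) -!starM !centralP h.
Qed.

Lemma lmul_linear m : linear (lmul m). Proof. by case: (lmul_bl m). Qed.

Lemma lmulM m a b : lmul m (a ** b) = lmul m a ** b.
Proof.
by apply: smul_faithful => c; rewrite -centralP !smulA -centralP.
Qed.

Lemma rmulM m a b : rmul m (a ** b) = a ** rmul m b.
Proof.
rewrite -[LHS]starK -[RHS]starK; congr star; apply: smul_faithful => c.
by rewrite -(starK c) -!starM centralP -!smulA centralP.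
Qed.

Lemma bounded_linear0 : bounded_linear (fun=> 0).
Proof.
split=> [c a b|]; first by rewrite scaler0 addr0.
by exists 0 => a; rewrite normr0 mul0r.
Qed.

Lemma bounded_linear_id : bounded_linear id.
Proof. by split=> //; exists 1 => a; rewrite mul1r. Qed.

Lemma bounded_linearZD (c : R[i]) (S T : A -> A) :
  bounded_linear S -> bounded_linear T ->
  bounded_linear (fun a => c *: S a + T a).
Proof.
move=> [Sl [KS bS]] [Tl [KT bT]]; split=> [d a b|].
  by rewrite Sl Tl !scalerDr !scalerA [c * d]mulrC addrACA.
exists (normR (c : R[i]^o) * KS + KT) => a.
have -> : (normR (c : R[i]^o) * KS + KT)%:C = `|c| * KS%:C + KT%:C.
  by rewrite -[in RHS](normRE (c : R[i]^o)) rmorphD rmorphM.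
rewrite mulrDl (le_trans (ler_normD _ _))//.
by rewrite lerD// normrZ -mulrA ler_wpM2l.
Qed.

Lemma bounded_linear_comp (S T : A -> A) :
  bounded_linear S -> bounded_linear T -> bounded_linear (S \o T).
Proof.
move=> [Sl [KS bS]] [Tl [KT bT]]; split=> [d a b|]; first by rewrite /= Tl Sl.
exists (Num.max 0 KS * KT) => a; rewrite [_%:C]rmorphM -mulrA.
apply: (le_trans (bS _)); apply: (@le_trans _ _ ((Num.max 0 KS)%:C * `|T a|)).
  by rewrite ler_wpM2r// lecR le_max lexx orbT.
by rewrite ler_wpM2l// ler0c le_max lexx.
Qed.

Lemma bounded_linear_star (T : A -> A) :
  bounded_linear T -> bounded_linear (fun a => star (T (star a))).
Proof.
move=> [Tl [K bT]]; split=> [d a b|].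
  by rewrite starD starZ Tl starD starZ conjCK.
by exists K => a; rewrite norm_star (le_trans (bT _))// norm_star.
Qed.

Fact mzero_central a b : (0 : A) ** b = a ** 0.
Proof. by rewrite smul0l smul0r. Qed.

Definition mzero : multiplier := @Multiplier (fun=> 0) (fun=> 0)
  bounded_linear0 bounded_linear0 mzero_central.

Definition mone : multiplier := @Multiplier id id
  bounded_linear_id bounded_linear_id (fun _ _ => erefl).

Fact mlin_central (c : R[i]) m n a b :
  (c *: rmul m a + rmul n a) ** b = a ** (c *: lmul m b + lmul n b).
Proof. by rewrite smulDl smulDr smulZl smulZr !centralP. Qed.

Definition mlin (c : R[i]) m n : multiplier :=
  Multiplier (bounded_linearZD c (lmul_bl m) (lmul_bl n))
    (bounded_linearZD c (rmul_bl m) (rmul_bl n)) (mlin_central c m n).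

Definition madd m n := mlin 1 m n.
Definition mopp m := mlin (-1) m mzero.
Definition mscale (c : R[i]) m := mlin c m mzero.

Fact mmul_central m n a b :
  (rmul n \o rmul m) a ** b = a ** (lmul m \o lmul n) b.
Proof. by rewrite /= !centralP. Qed.

Definition mmul m n : multiplier :=
  Multiplier (bounded_linear_comp (lmul_bl m) (lmul_bl n))
    (bounded_linear_comp (rmul_bl n) (rmul_bl m)) (mmul_central m n).

Fact mstar_central m a b :
  star (lmul m (star a)) ** b = a ** star (rmul m (star b)).
Proof. by rewrite -[b in LHS]starK -starM -centralP starM starK. Qed.

Definition mstar m : multiplier :=
  Multiplier (bounded_linear_star (rmul_bl m))
    (bounded_linear_star (lmul_bl m)) (mstar_central m).

Lemma maddE m n a : lmul (madd m n) a = lmul m a + lmul n a.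
Proof. by rewrite /= scale1r. Qed.

Lemma moppE m a : lmul (mopp m) a = - lmul m a.
Proof. by rewrite /= scaleN1r addr0. Qed.

Lemma mscaleE c m a : lmul (mscale c m) a = c *: lmul m a.
Proof. by rewrite /= addr0. Qed.

Lemma maddA : associative madd.
Proof. by move=> ? ? ?; apply: multiplier_eql => ?; rewrite !maddE addrA. Qed.
Lemma maddC : commutative madd.
Proof. by move=> ? ?; apply: multiplier_eql => ?; rewrite !maddE addrC. Qed.
Lemma madd0 : left_id mzero madd.
Proof. by move=> ?; apply: multiplier_eql => ?; rewrite !maddE add0r. Qed.
Lemma maddN : left_inverse mzero mopp madd.
Proof.
by move=> ?; apply: multiplier_eql => ?; rewrite maddE moppE addNr.
Qed.

HB.instance Definition _ :=
  GRing.isZmodule.Build multiplier maddA maddC madd0 maddN.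

Lemma mscaleA c d m : mscale c (mscale d m) = mscale (c * d) m.
Proof. by apply: multiplier_eql => ?; rewrite !mscaleE scalerA. Qed.
Lemma mscale1 : left_id 1 mscale.
Proof. by move=> ?; apply: multiplier_eql => ?; rewrite mscaleE scale1r. Qed.
Lemma mscaleDr : right_distributive mscale +%R.
Proof.
by move=> ? ? ?; apply: multiplier_eql => ?;
  rewrite maddE !mscaleE maddE scalerDr.
Qed.
Lemma mscaleDl m : {morph mscale^~ m : c d / c + d}.
Proof.
by move=> ? ?; apply: multiplier_eql => ?; rewrite maddE !mscaleE scalerDl.
Qed.

HB.instance Definition _ := GRing.Zmodule_isLmodule.Build R[i] multiplier
  mscaleA mscale1 mscaleDr mscaleDl.

Lemma lmulD m n a : lmul (m + n) a = lmul m a + lmul n a.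
Proof. exact: maddE. Qed.
Lemma lmulN m a : lmul (- m) a = - lmul m a.
Proof. exact: moppE. Qed.
Lemma lmulZ c m a : lmul (c *: m) a = c *: lmul m a.
Proof. exact: mscaleE. Qed.
Lemma lmul_argD m a b : lmul m (a + b) = lmul m a + lmul m b.
Proof. by have := lmul_linear m 1 a b; rewrite !scale1r. Qed.
Lemma lmul_arg0 m : lmul m 0 = 0.
Proof. by apply: (@addrI _ (lmul m 0)); rewrite -lmul_argD !addr0. Qed.
Lemma lmul_argZ m c a : lmul m (c *: a) = c *: lmul m a.
Proof. by have := lmul_linear m c a 0; rewrite lmul_arg0 !addr0. Qed.

(* The operator norm of the left component, which is also that of the right
   component. *)
Definition mnormR m : R := sup [set normR (lmul m a) | a in [set a | `|a| <= 1]].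

Lemma mnormR_has_sup m :
  has_sup [set normR (lmul m a) | a in [set a | `|a| <= 1]].
Proof.
split; first by exists (normR (lmul m 0)), 0; rewrite //= normr0.
have [_ [K bK]] := lmul_bl m; exists (Num.max 0 K) => _ [a /= a1 <-].
rewrite -lecR normRE; apply: (le_trans (bK a)).
apply: (@le_trans _ _ ((Num.max 0 K)%:C * `|a|)).
  by rewrite ler_wpM2r// lecR le_max lexx orbT.
by rewrite -[leRHS]mulr1 ler_wpM2l// ler0c le_max lexx.
Qed.

Lemma mnormR_ge0 m : 0 <= mnormR m.
Proof.
apply: (@le_trans _ _ (normR (lmul m 0))); first exact: normR_ge0.
apply: sup_upper_bound; first exact: mnormR_has_sup.
by exists 0; rewrite //= normr0.
Qed.

Lemma lmul_le_mnormR m a : `|lmul m a| <= (mnormR m)%:C * `|a|.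
Proof.
have [->|a0] := eqVneq a 0; first by rewrite lmul_arg0 !normr0 mulr0.
rewrite -ler_pdivrMr ?normr_gt0// mulrC.
rewrite -[X in X * _]ger0_norm ?invr_ge0// -normrZ -lmul_argZ -normRE lecR.
apply: sup_upper_bound; first exact: mnormR_has_sup.
exists (`|a|^-1 *: a) => //=.
by rewrite normrZ ger0_norm ?invr_ge0// mulVf// normr_eq0.
Qed.

Lemma mnormR_le m (K : R) :
  0 <= K -> (forall a, `|lmul m a| <= K%:C * `|a|) -> mnormR m <= K.
Proof.
move=> K0 mK; apply: ge_sup; first by have [] := mnormR_has_sup m.
move=> _ [a /= a1 <-]; rewrite -lecR normRE (le_trans (mK a))//.
by rewrite -[leRHS]mulr1 ler_wpM2l// ler0c.
Qed.

Definition mnorm m : R[i] := (mnormR m)%:C.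

Lemma mnormD m n : mnorm (m + n) <= mnorm m + mnorm n.
Proof.
rewrite /mnorm -[leRHS]rmorphD lecR mnormR_le ?addr_ge0 ?mnormR_ge0// => a.
rewrite lmulD [_%:C]rmorphD mulrDl (le_trans (ler_normD _ _))//.
by rewrite lerD ?lmul_le_mnormR.
Qed.

Lemma mnormZ_le c m : mnorm (c *: m) <= `|c| * mnorm m.
Proof.
have cE : (normR (c : R[i]^o) * mnormR m)%:C = `|c| * mnorm m.
  by rewrite -[in RHS](normRE (c : R[i]^o)) rmorphM.
rewrite -cE lecR mnormR_le ?mulr_ge0 ?normR_ge0 ?mnormR_ge0// => a.
by rewrite cE lmulZ normrZ -mulrA ler_wpM2l// lmul_le_mnormR.
Qed.

Lemma mnormZ c m : mnorm (c *: m) = `|c| * mnorm m.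
Proof.
apply/eqP; rewrite eq_le mnormZ_le/=.
have [->|c0] := eqVneq c 0; first by rewrite normr0 mul0r ler0c mnormR_ge0.
rewrite -ler_pdivlMl ?normr_gt0// -normfV.
by apply: le_trans (mnormZ_le _ _); rewrite scalerA mulVf// scale1r.
Qed.

Lemma mnorm_eq0 m : mnorm m = 0 -> m = 0.
Proof.
move=> m0; apply: multiplier_eql => a /=; apply/eqP; rewrite -normr_le0.
by rewrite (le_trans (lmul_le_mnormR _ _))// -/(mnorm m) m0 mul0r.
Qed.

HB.instance Definition _ :=
  Lmodule_isNormed.Build R[i] multiplier mnormD mnormZ mnorm_eq0.

Lemma mnormE m : `|m| = (mnormR m)%:C.
Proof. by []. Qed.

Lemma lmul_le m a : `|lmul m a| <= `|m| * `|a|.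
Proof. exact: lmul_le_mnormR. Qed.

Lemma mnorm_le m (K : R[i]) :
  0 <= K -> (forall a, `|lmul m a| <= K * `|a|) -> `|m| <= K.
Proof.
move=> K0 h; rewrite mnormE -(RRe_real (ger0_real K0)) lecR mnormR_le//.
  by rewrite -ler0c RRe_real// ger0_real.
by move=> a; rewrite RRe_real// ger0_real.
Qed.

Lemma rmulD m n a : rmul (m + n) a = rmul m a + rmul n a.
Proof. by rewrite /= scale1r. Qed.
Lemma rmulN m a : rmul (- m) a = - rmul m a.
Proof. by rewrite /= scaleN1r addr0. Qed.

Lemma rmulZ c m a : rmul (c *: m) a = c *: rmul m a.
Proof. by rewrite /= addr0. Qed.

Lemma rmul_le m a : `|rmul m a| <= `|m| * `|a|.
Proof.
have [->|ra0] := eqVneq (rmul m a) 0; first by rewrite normr0 mulr_ge0.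
rewrite -(ler_pM2r (x := `|rmul m a|)) ?normr_gt0// -expr2.
rewrite -[X in X ^+ 2]norm_star -norm_star_smul starK centralP.
rewrite (le_trans (norm_smul_le _ _))// [`|m| * _]mulrC -mulrA ler_wpM2l//.
by rewrite -[X in _ <= _ * X]norm_star lmul_le.
Qed.

Lemma cvg_smul (T : Type) (F : set_system T) (FF : Filter F) (f : T -> A) x b :
  f @ F --> x ->
  (f t ** b @[t --> F] --> x ** b) /\ (b ** f t @[t --> F] --> b ** x).
Proof.
have b0 : 0 < `|b| + 1 by rewrite ltr_wpDl.
move=> /cvgrPdist_lt fx; split; apply/cvgrPdist_lt => e e0;
  near=> t; rewrite -?smulBl -?smulBr (le_lt_trans (norm_smul_le _ _))//.
- apply: (@le_lt_trans _ _ (`|x - f t| * (`|b| + 1))).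
    by rewrite ler_wpM2l// lerDl.
  rewrite -ltr_pdivlMr//; near: t; apply: fx; exact: divr_gt0.
- apply: (@le_lt_trans _ _ ((`|b| + 1) * `|x - f t|)).
    by rewrite ler_wpM2r// lerDl.
  rewrite -ltr_pdivlMl//; near: t; apply: fx.
  by rewrite mulr_gt0// invr_gt0.
Unshelve. all: by end_near. Qed.

Lemma cauchy_pointwise (ev : multiplier -> A -> A) (F : set_system multiplier) :
  (forall m n a, ev (m - n) a = ev m a - ev n a) ->
  (forall m a, `|ev m a| <= `|m| * `|a|) ->
  (forall m, bounded_linear (ev m)) ->
  ProperFilter F -> cauchy F ->
  exists l : A -> A, [/\ bounded_linear l,
    forall a, ev m a @[m --> F] --> l a &
    forall e, 0 < e -> \forall m \near F, forall a, `|l a - ev m a| <= e * `|a|].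
Proof.
move=> evB ev_le ev_bl FF /cauchyP Fc.
have cl a : exists x : A, ev m a @[m --> F] --> x.
  suff h : cauchy (ev m a @[m --> F]).
    by exists (lim (ev m a @[m --> F])); exact: cauchy_cvg h.
  apply: cauchy_exP => e e0; have a0 : 0 < `|a| + 1 by rewrite ltr_wpDl.
  have [m Fm] := Fc _ (divr_gt0 e0 a0); exists (ev m a).
  suff : F [set n | ball (ev m a) e (ev n a)] by [].
  apply: filterS Fm => n; rewrite -!ball_normE /= => mn.
  rewrite -evB (le_lt_trans (ev_le _ _))//.
  apply: (@le_lt_trans _ _ (`|m - n| * (`|a| + 1))).
    by rewrite ler_wpM2l// lerDl.
  by rewrite -ltr_pdivlMr.
have [l ll] := choice cl.
have lunif e : 0 < e ->
    \forall m \near F, forall a, `|l a - ev m a| <= e * `|a|.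
  move=> e0; have [m0 Fm0] := Fc _ (divr_gt0 e0 (ltr0n _ 2)).
  rewrite -ball_normE in Fm0.
  apply: filterS (Fm0) => m /= m0m a; apply/ler_addgt0Pr => d d0.
  have /cvgrPdist_lt/(_ d d0) lad := ll a.
  have [n [/= lna m0n]] := filter_ex (filterI lad Fm0).
  rewrite -(subrKA (ev n a)) (le_trans (ler_normD _ _))// addrC lerD//.
    rewrite -evB (le_trans (ev_le _ _))// ler_wpM2r//.
    rewrite -(subrKA m0) (le_trans (ler_normD _ _))// [e]splitr lerD// ltW//.
    by rewrite distrC.
  exact: ltW.
exists l; split => //; split.
  move=> c a b.
  have h1 : ev m (c *: a + b) @[m --> F] --> c *: l a + l b.
    have -> : (fun m => ev m (c *: a + b)) = (fun m => c *: ev m a + ev m b).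
      by apply/funext => m; case: (ev_bl m) => ->.
    by apply: cvgD => //; exact: cvgZl_tmp.
  exact: (cvg_unique (@norm_hausdorff _ _) (ll _) h1).
have [m mF] := filter_ex (lunif 1 ltr01); exists (normR m + 1) => a.
have -> : (normR m + 1)%:C = `|m| + 1 by rewrite -(normRE m) rmorphD.
rewrite -(subrK (ev m a) (l a)) (le_trans (ler_normD _ _))// mulrDl addrC.
by rewrite lerD.
Qed.

Lemma multiplier_complete (F : set_system multiplier) :
  ProperFilter F -> cauchy F -> cvg F.
Proof.
move=> FF Fc.
have lB m n a : lmul (m - n) a = lmul m a - lmul n a by rewrite lmulD lmulN.
have rB m n a : rmul (m - n) a = rmul m a - rmul n a by rewrite rmulD rmulN.
have [l [l_bl ll lunif]] := cauchy_pointwise lB lmul_le lmul_bl FF Fc.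
have [r [r_bl rr _]] := cauchy_pointwise rB rmul_le rmul_bl FF Fc.
have cen a b : r a ** b = a ** l b.
  have [h1 _] := cvg_smul FF b (rr a).
  have [_ h2] := cvg_smul FF a (ll b).
  apply: (cvg_unique (@norm_hausdorff _ _) h1).
  suff -> : (fun m => rmul m a ** b) = (fun m => a ** lmul m b) by [].
  by apply/funext => m; exact: centralP.
apply/cvg_ex; exists (Multiplier l_bl r_bl cen); apply/cvgrPdist_le => e e0.
near=> m; apply: mnorm_le; first exact: ltW.
by move=> a; rewrite lB /=; move: a; near: m; exact: lunif.
Unshelve. all: by end_near. Qed.

HB.instance Definition _ := Uniform_isComplete.Build multiplier
  multiplier_complete.

Lemma mmulE m n a : lmul (mmul m n) a = lmul m (lmul n a).
Proof. by []. Qed.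
Lemma mstarE m a : lmul (mstar m) a = star (rmul m (star a)).
Proof. by []. Qed.

Lemma mmulA : associative mmul.
Proof. by move=> ? ? ?; exact: multiplier_eql. Qed.
Lemma mmulDl : left_distributive mmul +%R.
Proof. by move=> ? ? ?; apply: multiplier_eql => a; rewrite !(mmulE, lmulD). Qed.
Lemma mmulDr : right_distributive mmul +%R.
Proof.
by move=> m ? ?; apply: multiplier_eql => a; rewrite !(mmulE, lmulD) lmul_argD.
Qed.
Lemma mmulZl (c : R[i]) m n : mmul (c *: m) n = c *: mmul m n.
Proof. by apply: multiplier_eql => a; rewrite !(mmulE, lmulZ). Qed.
Lemma mmulZr (c : R[i]) m n : mmul m (c *: n) = c *: mmul m n.
Proof.
by apply: multiplier_eql => a; rewrite !(mmulE, lmulZ) lmul_argZ.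
Qed.
Lemma mstarK : involutive mstar.
Proof. by move=> m; apply: multiplier_eql => a; rewrite mstarE /= !starK. Qed.
Lemma mstarD : {morph mstar : m n / m + n}.
Proof.
by move=> m n; apply: multiplier_eql => a; rewrite lmulD !mstarE rmulD starD.
Qed.
Lemma mstarZ (c : R[i]) m : mstar (c *: m) = c^*%R *: mstar m.
Proof.
by apply: multiplier_eql => a; rewrite lmulZ !mstarE rmulZ starZ.
Qed.
Lemma mstarM m n : mstar (mmul m n) = mmul (mstar n) (mstar m).
Proof. by apply: multiplier_eql => a; rewrite /= starK. Qed.
Lemma norm_mmul_le m n : `|mmul m n| <= `|m| * `|n|.
Proof.
apply: mnorm_le; first exact: mulr_ge0.
by move=> a; rewrite mmulE -mulrA (le_trans (lmul_le _ _))// ler_wpM2l// lmul_le.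
Qed.
Lemma norm_mstar m : `|mstar m| = `|m|.
Proof.
have le n : `|mstar n| <= `|n|.
  apply: mnorm_le => // a; rewrite mstarE norm_star -[X in _ <= _ * X]norm_star.
  exact: rmul_le.
by apply/eqP; rewrite eq_le le -{1}(mstarK m) le.
Qed.
Lemma norm_mstar_mmul m : `|mmul (mstar m) m| = `|m| ^+ 2.
Proof.
apply/eqP; rewrite eq_le; apply/andP; split.
  by rewrite (le_trans (norm_mmul_le _ _))// norm_mstar expr2.
have sq0 : 0 <= sqrtC `|mmul (mstar m) m| by rewrite sqrtC_ge0.
rewrite -[leRHS]sqrtCK ler_sqr ?nnegrE//; apply: mnorm_le => // a.
rewrite -ler_sqr ?nnegrE ?mulr_ge0// exprMn sqrtCK -norm_star_smul.
rewrite -centralP (le_trans (norm_smul_le _ _))//.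
rewrite expr2 mulrA ler_wpM2r//.
have -> : `|rmul m (star (lmul m a))| = `|lmul (mmul (mstar m) m) a|.
  by rewrite mmulE mstarE norm_star.
exact: lmul_le.
Qed.

HB.instance Definition _ := isCStarAlgebra.Build R[i] multiplier
  mmulA mmulDl mmulDr mmulZl mmulZr mstarK mstarD mstarZ mstarM
  norm_mmul_le norm_mstar_mmul.

Fact mult_of_bl (a : A) :
  bounded_linear (fun b => a ** b) /\ bounded_linear (fun b => b ** a).
Proof.
split; (split; last by exists (normR a) => b;
  rewrite normRE (le_trans (norm_smul_le _ _))// mulrC).
- by move=> c x y; rewrite smulDr smulZr.
- by move=> c x y; rewrite smulDl smulZl.
Qed.

Definition mult_of (a : A) : multiplier :=
  Multiplier (mult_of_bl a).1 (mult_of_bl a).2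
    (fun b c => esym (smulA b a c)).

Definition strict_coords m : {ptws A -> A} * {ptws A -> A} := (lmul m, rmul m).

(* M(A) with its strict topology, generated by the seminorms
   m |-> |m a| and m |-> |a m| for a in A. *)
Definition strict_multiplier := initial_topology strict_coords.

HB.instance Definition _ := Topological.on strict_multiplier.

End multiplier_algebra.

Lemma strict_cvgP (R : realType) (A : cstarAlgType R[i])
    (F : set_system (multiplier A)) (FF : Filter F) (m : multiplier A) :
  F --> (m : strict_multiplier A) <->
  (forall a, lmul n a @[n --> F] --> lmul m a) /\
  (forall a, rmul n a @[n --> F] --> rmul m a).
Proof.
pose l n : {ptws A -> A} := @lmul R A n; pose r n : {ptws A -> A} := @rmul R A n.
have lP : l n @[n --> F] --> l m <-> forall a, lmul n a @[n --> F] --> lmul m a.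
  exact: pointwise_cvgP.
have rP : r n @[n --> F] --> r m <-> forall a, rmul n a @[n --> F] --> rmul m a.
  exact: pointwise_cvgP.
rewrite -lP -rP; split=> [Fm|[Fl Fr]].
  have Fc : strict_coords n @[n --> F] --> strict_coords m.
    have cm := @initial_continuous _ _ (@strict_coords R A) m.
    by move=> X /cm /Fm.
  split.
    by apply: (cvg_comp (@strict_coords R A) fst Fc); exact: cvg_fst.
  by apply: (cvg_comp (@strict_coords R A) snd Fc); exact: cvg_snd.
have Fc : strict_coords n @[n --> F] --> strict_coords m := cvg_pair Fl Fr.
move=> X; rewrite nbhsE => -[U [[B Bo <-] Bm] UX]; apply: filterS UX _.
by apply: Fc; exact: open_nbhs_nbhs.
Qed.

Section cstar_notions.
Context (C : numClosedFieldType).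

Definition self_adjoint (A : cstarAlgType C) (a : A) : Prop := star a = a.

Definition positive (A : cstarAlgType C) (a : A) : Prop :=
  exists b, a = star b ** b.

Definition star_hom (A B : cstarAlgType C) (f : A -> B) : Prop :=
  [/\ linear f, {morph f : a b / a ** b} & {morph f : a / star a}].

End cstar_notions.

Section nets.

Definition directed (D : Type) (le : D -> D -> Prop) : Prop :=
  [/\ inhabited D, (forall i, le i i),
      (forall i j k, le i j -> le j k -> le i k) &
      (forall i j, exists k, le i k /\ le j k)].

(* Convergence of a net u indexed by D is convergence of u @ tails le. *)
Definition tails (D : Type) (le : D -> D -> Prop) : set_system D :=
  [set P | exists i, forall j, le i j -> P j].

Lemma tails_filter (D : Type) (le : D -> D -> Prop) :
  directed le -> ProperFilter (tails le).
Proof.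
move=> [[d] refl trans dir]; split; first by case=> i /(_ _ (refl i)).
split; first by exists d.
- move=> P Q [i Pi] [j Qj]; have [k [ik jk]] := dir i j.
  by exists k => l kl; split; [apply: Pi|apply: Qj]; apply: trans kl.
- by move=> P Q PQ [i Pi]; exists i => j /Pi/PQ.
Qed.

Definition approximate_identity (C : numClosedFieldType) (A : cstarAlgType C)
    (D : Type) (le : D -> D -> Prop) (I : D -> A) : Prop :=
  [/\ directed le, (forall i, positive (I i) /\ `|I i| <= 1),
      (forall a, I i ** a @[i --> tails le] --> a) &
      (forall a, a ** I i @[i --> tails le] --> a)].

Definition increasing_net (C : numClosedFieldType) (A : cstarAlgType C)
    (D : Type) (le : D -> D -> Prop) (I : D -> A) : Prop :=
  forall i j, le i j -> positive (I j - I i).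

End nets.

Section states.
Context (R : realType).

Definition functional_norm (A : cstarAlgType R[i]) (phi : A -> R[i]) : \bar R :=
  ereal_sup [set (complex.Re `|phi a|)%:E | a in [set a | `|a| <= 1]].

Definition states (A : cstarAlgType R[i]) : set (A -> R[i]) :=
  [set phi | [/\ scalar phi, (forall a, 0 <= phi (star a ** a)) &
                 functional_norm phi = 1%:E]].

Variable A : cstarAlgType R[i].

Definition strictly_continuous (psi : multiplier A -> R[i]) : Prop :=
  continuous (psi : strict_multiplier A -> (R[i] : numFieldType)^o).

(* The identification of S(A) with the strictly continuous states of M(A). The
   default value 0 is irrelevant: the extension of a state exists and is unique. *)
Definition strict_ext (phi : A -> R[i]) : multiplier A -> R[i] :=
  xget (fun=> 0) [set psi | [/\ states psi, strictly_continuous psi &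
                                psi \o @mult_of R A = phi]].

End states.

Section dual_ifs.
Context (R : realType) (A : cstarAlgType R[i]).

(* The limit of f (I_n) is the unit of M(B), since f is to have a unital
   extension M(A) -> M(B) that is strictly continuous on the unit ball. *)
Definition relatively_proper (B : cstarAlgType R[i]) (f : A -> multiplier B) :
    Prop :=
  star_hom f /\
  exists (D : Type) (le : D -> D -> Prop) (I : D -> A),
    [/\ approximate_identity le I, increasing_net le I &
        (f (I i) : strict_multiplier B) @[i --> tails le] -->
          (mone B : strict_multiplier B)].

Definition is_dual_ifs (k : nat) (f : 'I_k -> A -> multiplier A) : Prop :=
  forall i, relatively_proper (f i).

Definition prob_simplex (k : nat) : set ('I_k -> R) :=
  [set p | (forall i, 0 <= p i <= 1) /\ \sum_(i < k) p i = 1].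

(* phi o f_i is formed with the strict extension of phi to M(A). *)
Definition ifs_dual (k : nat) (f : 'I_k -> A -> multiplier A) (p : 'I_k -> R)
    (phi : A -> R[i]) : A -> R[i] :=
  fun a => \sum_(i < k) (p i)%:C * strict_ext phi (f i a).

Definition self_similar (k : nat) (f : 'I_k -> A -> multiplier A)
    (p : 'I_k -> R) : set (A -> R[i]) :=
  [set phi | states phi /\ phi = ifs_dual f p phi].

End dual_ifs.

Section spectral_metric_space.
Context (R : realType) (A : cstarAlgType R[i]).
Local Open Scope ereal_scope.

(* Only the values of L : A -> \bar R on self-adjoint elements matter. *)
Definition extended_seminorm (L : A -> \bar R) : Prop :=
  [/\ (forall a, self_adjoint a -> 0 <= L a),
      (forall (t : R) a, self_adjoint a -> L (t%:C *: a)%R = `|t|%:E * L a) &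
      (forall a b, self_adjoint a -> self_adjoint b ->
         L (a + b)%R <= L a + L b)].

Definition extended_complete_spectral_metric_space (L : A -> \bar R) : Prop :=
  [/\ extended_seminorm L,
      [set a | self_adjoint a] `<=`
        closure [set c | self_adjoint c /\ L c < +oo],
      (exists (D : Type) (le : D -> D -> Prop) (I : D -> A),
         approximate_identity le I /\ L (I i) @[i --> tails le] --> 0) &
      (forall c : R, (0 <= c)%R ->
         closed [set b | self_adjoint b /\ L b <= c%:E])].

Definition lip_ball (L : A -> \bar R) : set A :=
  [set b | self_adjoint b /\ L b <= 1].

Definition dist_states (L : A -> \bar R) (phi psi : A -> R[i]) : \bar R :=
  ereal_sup [set (complex.Re `|phi b - psi b|%R)%:E | b in lip_ball L].

(* The common formula for L on A^sa and on M(A)^sa: ev is evaluation of states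
   at the given element. *)
Definition lip_const (L : A -> \bar R) (ev : (A -> R[i]) -> R[i]) : \bar R :=
  ereal_inf [set C%:E | C in [set C : R | (0 < C)%R /\
    forall phi psi, states phi -> states psi ->
      (complex.Re `|ev phi - ev psi|%R)%:E <= C%:E * dist_states L phi psi]].

Definition lip_recovers (L : A -> \bar R) : Prop :=
  forall b, self_adjoint b -> L b = lip_const L (fun phi => phi b).

Definition lip_ext (L : A -> \bar R) (m : multiplier A) : \bar R :=
  lip_const L (fun phi => strict_ext phi m).

Definition dilation (L : A -> \bar R) (f : A -> multiplier A) : \bar R :=
  ereal_sup [set lip_ext L (f b) | b in lip_ball L].

(* In \bar R, 0 * +oo = 0. *)
Definition mean_dilation (L : A -> \bar R) (k : nat)
    (f : 'I_k -> A -> multiplier A) (p : 'I_k -> R) : \bar R :=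
  \sum_(i < k) (p i)%:E * dilation L (f i).

End spectral_metric_space.

(* Main.v *)
(** The dual map is a contraction for d_L with ratio at most the mean dilation,
    so the orbit of phi0 is d_L-Cauchy. It converges pointwise because the
    elements of finite L are dense, and no mass escapes in the limit because
    L(I_n) -> 0 makes the convergence on the approximate identity uniform.

    The dual map has to be shown to act on states. A state extends strictly to
    M(A) because, by Cohen factorization, it is dominated by x |-> |x a| for some
    a in A. The pullback of a state psi along a *-homomorphism f is contractive:
    a self-adjoint a with |a| <= 1/2 can be written 1 - (1 - y)^2 with y = y^*,
    which bounds psi (f (x^* a x)) by psi (f (x^* x)), and repeated use of the
    Cauchy-Schwarz inequality removes the constant lost. *)

Require Import Defs.
From mathcomp Require Import all_boot all_order all_algebra.
From mathcomp Require Import complex ring lra.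
From mathcomp Require Import all_classical all_reals.
From mathcomp Require Import ereal topology normedtype sequences.

Set Implicit Arguments.
Unset Strict Implicit.
Unset Printing Implicit Defensive.

Import Order.TTheory GRing.Theory Num.Theory.
Import numFieldNormedType.Exports.

Local Open Scope classical_set_scope.
Local Open Scope ring_scope.
Local Open Scope complex_scope.

(** Positivity means only being of the form [star b ** b]: no order on [A] and no spectrum enters.
    Every estimate on a state therefore rests on explicit squares and on Cauchy-Schwarz. Without a
    unit, a state has norm one without having to attain it, so total mass is tested along an
    approximate identity, where every state tends to 1; the same test serves for limits, pullbacks
    and convex combinations. Knowing that [phi (x ** I i)] tends to [phi x] for each [x] does not
    bound [phi] by one strict seminorm, which is what strict continuity demands; Cohen's
    construction supplies that single seminorm. As [d_L] may be infinite, contraction estimates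
    carry a real bound [D] instead of the distance itself. *)

Section real_valued_norm.
Context (R : realType).

(** * Real-valued norms and complex numbers *)

Section zmod.
Context (V : normedZmodType R[i]).
Implicit Types x y : V.

Lemma normRD x y : normR (x + y) <= normR x + normR y.
Proof. by rewrite -lecR [X in _ <= X]rmorphD /= !normRE ler_normD. Qed.

Lemma normRN x : normR (- x) = normR x.
Proof. by rewrite /normR normrN. Qed.

Lemma normR_distC x y : normR (x - y) = normR (y - x).
Proof. by rewrite -normRN opprB. Qed.

Lemma normR0 : normR (0 : V) = 0.
Proof. by rewrite /normR normr0. Qed.

Lemma normR_le0 x : normR x <= 0 -> x = 0.
Proof. by rewrite -lecR normRE normr_le0 => /eqP. Qed.

Lemma normR_le1 x : (`|x| <= 1) = (normR x <= 1).
Proof. by rewrite -lecR normRE. Qed.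

Lemma normR_dist_add x y z : normR (x - z) <= normR (x - y) + normR (y - z).
Proof. by rewrite -[x - z](subrKA y) normRD. Qed.

End zmod.

Section complex_numbers.
Implicit Types c d : R[i].

Lemma normRM c d : normR (c * d) = normR c * normR d.
Proof. by apply: complexI; rewrite rmorphM /= !normRE normrM. Qed.

Lemma normR_real (r : R) : normR (r%:C : R[i]) = `|r|.
Proof. by rewrite /normR normc_def /= expr0n addr0 sqrtr_sqr. Qed.

Lemma Re_le_normR c : complex.Re c <= normR c.
Proof.
rewrite /normR normc_def /= (le_trans (ler_norm _))// -sqrtr_sqr ler_wsqrtr//.
by rewrite lerDl sqr_ge0.
Qed.

Lemma ReD c d : complex.Re (c + d) = complex.Re c + complex.Re d.
Proof. by case: c; case: d. Qed.

Lemma ReN c : complex.Re (- c) = - complex.Re c.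
Proof. by case: c. Qed.

Lemma ReB c d : complex.Re (c - d) = complex.Re c - complex.Re d.
Proof. by rewrite ReD ReN. Qed.

Lemma ImB c d : complex.Im (c - d) = complex.Im c - complex.Im d.
Proof. by case: c; case: d. Qed.

Lemma Re_realM (r : R) c : complex.Re (r%:C * c) = r * complex.Re c.
Proof. by case: c => a b /=; rewrite mul0r subr0. Qed.

Lemma sqr_normR c : normR c ^+ 2 = complex.Re c ^+ 2 + complex.Im c ^+ 2.
Proof. by apply: complexI; rewrite rmorphXn /= normRE add_Re2_Im2. Qed.

Lemma normR_le_ReIm c :
  normR c <= `|complex.Re c| + `|complex.Im c|.
Proof.
rewrite -(@ler_pXn2r _ 2)// ?nnegrE ?normR_ge0 ?addr_ge0//.
rewrite sqr_normR sqrrD !real_normK ?num_real//.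
by have := mulr_ge0 (normr_ge0 (complex.Re c)) (normr_ge0 (complex.Im c)); lra.
Qed.

Lemma Re_normR c : `|complex.Re c| <= normR c.
Proof.
rewrite -(@ler_pXn2r _ 2)// ?nnegrE ?normR_ge0// sqr_normR real_normK ?num_real//.
by rewrite lerDl sqr_ge0.
Qed.

Lemma Im_normR c : `|complex.Im c| <= normR c.
Proof.
rewrite -(@ler_pXn2r _ 2)// ?nnegrE ?normR_ge0// sqr_normR real_normK ?num_real//.
by rewrite lerDr sqr_ge0.
Qed.

Lemma ge0_approx c :
  (forall e : R, 0 < e -> exists2 d, 0 <= d & normR (c - d) <= e) -> 0 <= c.
Proof.
move=> h; rewrite lecE /=; apply/andP; split.
  rewrite -normr_le0; apply/ler_addgt0Pr => e e0; rewrite add0r.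
  have [[d1 d2]] := h _ e0; rewrite lecE /= => /andP[/eqP -> _].
  by move=> /(le_trans (Im_normR _)); case: c {h} => a b /=; rewrite subr0.
apply/ler_addgt0Pr => e e0; have [[d1 d2]] := h _ e0.
rewrite lecE /= => /andP[_ d10] /(le_trans (Re_normR _)).
by case: c {h} => a b /=; rewrite ler_norml => /andP[]; lra.
Qed.

End complex_numbers.

Section normed_module.
Context (V : normedModType R[i]).

Lemma normRZ (c : R[i]) (x : V) : normR (c *: x) = normR c * normR x.
Proof. by apply: complexI; rewrite rmorphM /= !normRE normrZ. Qed.

Lemma cvg_normR (T : Type) (F : set_system T) (FF : Filter F) (g : T -> V) l :
  g t @[t --> F] --> l <->
  forall e : R, 0 < e -> \forall t \near F, normR (l - g t) < e.
Proof.
rewrite (cvgrPdist_lt (FF := FF)); split=> h e e0.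
  have e0' : 0 < e%:C by rewrite ltcR.
  by apply: filterS (h _ e0') => t; rewrite -normRE ltcR.
have eR : (complex.Re e)%:C = e by rewrite RRe_real// gtr0_real.
have e0' : 0 < complex.Re e by rewrite -ltcR eR.
by apply: filterS (h _ e0') => t; rewrite -eR -normRE ltcR.
Qed.

End normed_module.

Section cstar.
Context (A : cstarAlgType R[i]).
Implicit Types a b : A.

Lemma normR_smul a b : normR (a ** b) <= normR a * normR b.
Proof. by rewrite -lecR [X in _ <= X]rmorphM /= !normRE norm_smul_le. Qed.

Lemma normR_star a : normR (star a) = normR a.
Proof. by rewrite /normR norm_star. Qed.

Lemma normR_star_smul a : normR (star a ** a) = normR a ^+ 2.
Proof. by apply: complexI; rewrite rmorphXn /= !normRE norm_star_smul. Qed.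

Lemma starN a : star (- a) = - star a.
Proof. by rewrite -scaleN1r starZ rmorphN1 scaleN1r. Qed.

Lemma starB a b : star (a - b) = star a - star b.
Proof. by rewrite starD starN. Qed.

Lemma star_realZ (r : R) a : star (r%:C *: a) = r%:C *: star a.
Proof. by rewrite starZ conj_Creal// complex_real. Qed.

Lemma positive_self_adjoint a : positive a -> self_adjoint a.
Proof. by move=> [b ->]; rewrite /self_adjoint starM starK. Qed.

End cstar.

(* [R[i]] carries no completeness instance, hence the detour through [R]. *)
Lemma complex_cauchy_cvg (T : Type) (F : set_system T) (FF : ProperFilter F)
    (g : T -> R[i]) :
  (forall e : R, 0 < e -> exists c, \forall t \near F, normR (c - g t) < e) ->
  exists l, forall e : R, 0 < e -> \forall t \near F, normR (l - g t) < e.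
Proof.
move=> h.
have real_cvg (pr : R[i] -> R) :
    (forall c d, pr (c - d) = pr c - pr d) -> (forall c, `|pr c| <= normR c) ->
    exists l : R, forall e, 0 < e -> \forall t \near F, `|l - pr (g t)| < e.
  move=> prB pr_le; suff : cvg (pr (g t) @[t --> F]).
    move=> /cvg_ex[l /cvgrPdist_lt hl]; by exists l.
  apply: cauchy_cvg; apply: cauchy_exP => e e0; have [c hc] := h e e0.
  exists (pr c).
  suff : F [set t | ball (pr c) e (pr (g t))] by [].
  apply: filterS hc => t; rewrite -ball_normE /= -prB.
  exact: le_lt_trans.
have [l1 h1] := real_cvg (@complex.Re R) ReB Re_normR.
have [l2 h2] := real_cvg (@complex.Im R) ImB Im_normR.
exists (l1 +i* l2) => e e0; have e2 : 0 < e / 2 by rewrite divr_gt0.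
apply: filterS2 (h1 _ e2) (h2 _ e2) => t H1 H2.
apply: (le_lt_trans (normR_le_ReIm _)); rewrite ReB ImB /=; lra.
Qed.

End real_valued_norm.

(** * Positive functionals and the Cauchy-Schwarz inequality *)

Section positive_functionals.
Context (R : realType) (A : cstarAlgType R[i]).
Implicit Types (a b x : A) (phi : A -> R[i]).

Definition positive_functional phi : Prop :=
  scalar phi /\ forall a, 0 <= phi (star a ** a).

Section scalar_functional.
Context (phi : A -> R[i]) (lin : scalar phi).

Lemma sfunD a b : phi (a + b) = phi a + phi b.
Proof. by have := lin 1 a b; rewrite scale1r mul1r. Qed.

Lemma sfun0 : phi 0 = 0.
Proof. by apply: (@addrI _ (phi 0)); rewrite -sfunD !addr0. Qed.

Lemma sfunZ (c : R[i]) a : phi (c *: a) = c * phi a.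
Proof. by have := lin c a 0; rewrite !addr0 sfun0 addr0. Qed.

Lemma sfunN a : phi (- a) = - phi a.
Proof. by rewrite -scaleN1r sfunZ mulN1r. Qed.

Lemma sfunB a b : phi (a - b) = phi a - phi b.
Proof. by rewrite sfunD sfunN. Qed.

End scalar_functional.

(** Polarization: [phi] is real at [star x ** x] for [x = c a + b], and [c = 1], [c = 'i] give the
    two coordinates. Without a unit only products are accessible this way. *)
Lemma posf_hermitian phi : positive_functional phi ->
  forall a b, phi (star b ** a) = (phi (star a ** b))^*%C.
Proof.
move=> [lin pos] a b.
have expand (c : R[i]) : complex.Im (phi (star (c *: a + b) ** (c *: a + b)))
    = complex.Im (c^*%C * phi (star a ** b) + c * phi (star b ** a)).
  rewrite starD starZ smulDl !smulDr !smulZl !smulZr.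
  rewrite !(sfunD lin) !(sfunZ lin).
  have := ger0_Im (pos a); have := ger0_Im (pos b).
  case: (phi (star a ** a)) => aa aa'; case: (phi (star b ** b)) => bb bb' /=.
  move=> -> ->; case: (phi (star a ** b)) => ab ab'.
  by case: (phi (star b ** a)) => ba ba'; case: c => c c' /=; ring.
have := expand 1; have := expand 'i.
rewrite !(ger0_Im (pos _)).
case: (phi (star a ** b)) => ab ab'; case: (phi (star b ** a)) => ba ba' /=.
by move=> h1 h2; congr Complex; lra.
Qed.

(** The quadratic is the value of [phi] at the square of [t z a + b], where [z = phi (star a ** b)]
    and [s = |z|^2]. It is evaluated at its minimum [t = -1/P], or, if [P = 0], at a [t] that makes
    it -1. *)
Lemma real_quadratic_bound (P Q s : R) : 0 <= P -> 0 <= s ->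
  (forall t : R, 0 <= t ^+ 2 * s * P + 2 * t * s + Q) -> s <= P * Q.
Proof.
move=> P0 s0 h; have [P_0|Pneq0] := eqVneq P 0.
  rewrite P_0 mul0r leNgt; apply/negP => sgt0.
  have := h (- (Q + 1) / (2 * s)).
  rewrite P_0 mulr0 add0r.
  have -> : 2 * (- (Q + 1) / (2 * s)) * s = - (Q + 1) by field; rewrite gt_eqF.
  by lra.
have Pgt0 : 0 < P by rewrite lt_neqAle eq_sym Pneq0.
have := h (- P^-1).
have -> : (- P^-1) ^+ 2 * s * P + 2 * - P^-1 * s + Q = Q - s / P by field.
by rewrite subr_ge0 ler_pdivrMr// mulrC.
Qed.

Lemma posf_CS phi : positive_functional phi -> forall a b,
  normR (phi (star a ** b)) ^+ 2 <=
  complex.Re (phi (star a ** a)) * complex.Re (phi (star b ** b)).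
Proof.
move=> pf; have herm := posf_hermitian pf; case: pf => lin pos a b.
have Re0 x : 0 <= complex.Re (phi (star x ** x)).
  by have := pos x; rewrite lecE => /andP[].
set z := phi (star a ** b).
apply: real_quadratic_bound => [||t]; [exact: Re0|exact: sqr_ge0|].
suff <- : complex.Re (phi (star ((t%:C * z) *: a + b) ** ((t%:C * z) *: a + b)))
   = t ^+ 2 * normR z ^+ 2 * complex.Re (phi (star a ** a)) + 2 * t * normR z ^+ 2
     + complex.Re (phi (star b ** b)) by exact: Re0.
rewrite starD starZ smulDl !smulDr !smulZl !smulZr.
rewrite !(sfunD lin) !(sfunZ lin) (herm a b) -/z sqr_normR.
have := ger0_Im (pos a); have := ger0_Im (pos b).
case: (phi (star a ** a)) => aa aa'; case: (phi (star b ** b)) => bb bb' /=.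
by move=> -> ->; case: z => z1 z2 /=; ring.
Qed.

Lemma state_posf phi : states phi -> positive_functional phi.
Proof. by case. Qed.

Lemma state_le phi : states phi -> forall a, normR (phi a) <= normR a.
Proof.
move=> [lin _ n1] a; have [->|a0] := eqVneq a 0.
  by rewrite (sfun0 lin) !normR0.
have na0 : 0 < normR a.
  by rewrite lt_neqAle normR_ge0 andbT eq_sym; apply: contra a0 => /eqP na;
    rewrite (normR_le0 (x := a)) ?na.
rewrite -[leRHS]mul1r -ler_pdivrMr// -lee_fin -n1; apply: ereal_sup_ubound.
exists ((normR a)^-1%:C *: a) => /=.
  rewrite normR_le1 normRZ normR_real ger0_norm ?invr_ge0 ?normR_ge0//.
  by rewrite mulVf// gt_eqF.
rewrite (sfunZ lin); congr (_%:E).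
rewrite mulrC -[(normR a)^-1 in RHS]ger0_norm ?invr_ge0 ?normR_ge0//.
by rewrite -normR_real -normRM.
Qed.

Lemma state_attained phi : states phi -> forall e : R, 0 < e ->
  exists2 a, normR a <= 1 & 1 - e < normR (phi a).
Proof.
move=> [_ _ n1] e e0.
have : ((1 - e)%:E < functional_norm phi)%E by rewrite n1 lte_fin; lra.
move=> /ereal_sup_gt[_ [a /= a1 <-]]; rewrite lte_fin => h.
by exists a => //; rewrite -normR_le1.
Qed.

Lemma stateI phi : positive_functional phi ->
  (forall a, normR (phi a) <= normR a) ->
  (forall e : R, 0 < e -> exists2 a, normR a <= 1 & 1 - e < normR (phi a)) ->
  states phi.
Proof.
move=> [lin pos] le1 att; split => //; apply/eqP; rewrite eq_le; apply/andP; split.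
  apply: ge_ereal_sup => _ [a /= a1 <-]; rewrite lee_fin.
  by apply: le_trans (le1 a) _; rewrite -normR_le1.
apply/lee_subgt0Pr => e e0; have [a a1 ha] := att e e0.
apply: (@le_trans _ _ (normR (phi a))%:E); first by rewrite lee_fin ltW.
by apply: ereal_sup_ubound; exists a => //=; rewrite normR_le1.
Qed.

End positive_functionals.

(** * States along an approximate identity *)

Section approximate_identities.
Context (R : realType) (A : cstarAlgType R[i]).
Context (D : Type) (le : D -> D -> Prop) (I : D -> A).
Hypothesis ai : approximate_identity le I.
Implicit Types (a b x : A) (phi : A -> R[i]).

Lemma ai_filter : ProperFilter (tails le).
Proof. by case: ai => dir *; exact: tails_filter. Qed.

Lemma ai_self_adjoint i : star (I i) = I i.
Proof. by case: ai => _ /(_ i)[/positive_self_adjoint]. Qed.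

Lemma ai_norm i : normR (I i) <= 1.
Proof. by case: ai => _ /(_ i)[_]; rewrite normR_le1. Qed.

Lemma ai_mull a (e : R) : 0 < e ->
  \forall i \near tails le, normR (a - I i ** a) < e.
Proof.
by case: ai => dir _ h _; have FF := tails_filter dir;
  exact: (cvg_normR _ _ _).1 (h a) e.
Qed.

Lemma ai_mulr a (e : R) : 0 < e ->
  \forall i \near tails le, normR (a - a ** I i) < e.
Proof.
by case: ai => dir _ _ h; have FF := tails_filter dir;
  exact: (cvg_normR _ _ _).1 (h a) e.
Qed.

Section state.
Context (phi : A -> R[i]) (st : states phi).
Let pf := state_posf st.
Let lin : scalar phi := pf.1.

Lemma state_Re_bounds a :
  0 <= complex.Re (phi (star a ** a)) <= normR a ^+ 2.
Proof.
apply/andP; split; first by have := pf.2 a; rewrite lecE => /andP[].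
by rewrite -normR_star_smul (le_trans (Re_le_normR _))// state_le.
Qed.

(** The norm is nearly attained at some [a], and [phi (I i ** a)] is close to [phi a]. Writing
    [I i = star b ** b], Cauchy-Schwarz for [b] and [b ** a] bounds [|phi (I i ** a)|^2] by
    [phi (I i)], because the other factor is at most 1. *)
Lemma state_ai_to1 (e : R) : 0 < e ->
  \forall i \near tails le, 1 - e < complex.Re (phi (I i)).
Proof.
(* The lower bound on [|phi (I i ** a)|] will be [1 - 2 d]: its square exceeds [1 - e] since
   [d <= e / 4], and [d <= 1 / 4] makes it nonnegative before squaring. *)
move=> e0; pose d := Num.min (e / 4) (1 / 4).
have [d0 de d4] : [/\ 0 < d, d <= e / 4 & d <= 1 / 4].
  by rewrite /d lt_min !ge_min !lexx orbT; split => //; lra.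
have [a a1 ha] := state_attained st d0.
have FF := ai_filter.
apply: filterS (ai_mull a d0) => i hi.
have [b bE] : positive (I i) by case: ai => _ /(_ i)[].
have := posf_CS pf b (b ** a).
rewrite starM smulA -bE smulA -(smulA (star a)) -bE -(smulA (star a)).
have Ia : normR (I i ** a) <= 1.
  by rewrite (le_trans (normR_smul _ _))// mulr_ile1 ?normR_ge0// ai_norm.
have z1 : complex.Re (phi (star a ** (I i ** a))) <= 1.
  rewrite (le_trans (Re_le_normR _))// (le_trans (state_le st _))//.
  rewrite (le_trans (normR_smul _ _))// mulr_ile1 ?normR_ge0//.
  by rewrite normR_star.
have := pf.2 b; rewrite -bE lecE => /andP[_].
have := state_le st (a - I i ** a); rewrite (sfunB lin).
have : normR (phi a) <= normR (phi a - phi (I i ** a)) + normR (phi (I i ** a)).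
  by rewrite -{1}[phi a](subrK (phi (I i ** a))) normRD.
have := normR_ge0 (phi (I i ** a)).
move: ha z1; set u := normR (phi a); set v := normR (phi (I i ** a)).
set z := complex.Re _; set w := complex.Re (phi (I i)) => ? ? ? ? ? w0 vwz.
have vw : v ^+ 2 <= w by rewrite (le_trans vwz)// ler_piMr.
have dv : 1 - 2 * d <= v by lra.
have : (1 - 2 * d) ^+ 2 <= v ^+ 2.
  rewrite lerXn2r ?nnegrE//.
  lra.
have : 0 < d ^+ 2 by rewrite exprn_gt0.
by rewrite !expr2; lra.
Qed.

Lemma state_ai_Re_le1 i : complex.Re (phi (I i)) <= 1.
Proof.
by rewrite (le_trans (Re_le_normR _))// (le_trans (state_le st _))// ai_norm.
Qed.

Lemma state_ai_cvg1 (e : R) : 0 < e ->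
  \forall i \near tails le, normR (1 - phi (I i)) < e.
Proof.
move=> e0; have FF := ai_filter; apply: filterS (state_ai_to1 e0) => i hi.
have [b bE] : positive (I i) by case: ai => _ /(_ i)[].
have : 0 <= phi (I i) by rewrite bE; exact: pf.2.
have := state_ai_Re_le1 i; move: hi.
case: (phi (I i)) => x y /= h1 h2; rewrite lecE /= => /andP[/eqP -> x0].
have -> : 1 - x +i* 0 = (1 - x)%:C by apply/eqP; rewrite eq_complex /= oppr0 addr0 !eqxx.
rewrite normR_real ger0_norm; lra.
Qed.

(** The index is chosen before [x], as Cohen's construction needs. Cauchy-Schwarz separates [x] from
    [I j - I i], and only the auxiliary [j] depends on [x]. *)
Lemma state_ai_small (d : R) : 0 < d ->
  \forall i \near tails le, forall x, normR (phi (x - x ** I i)) <= d * normR x.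
Proof.
move=> d0; have FF := ai_filter.
(* Expanding the square of [I j - I i] under [phi] leaves at most [2 - 2 Re phi (I j ** I i)]. For
   late [j] this is at most [4 e], which is to equal [d^2]. *)
have e0 : 0 < d ^+ 2 / 4 by rewrite divr_gt0// exprn_gt0.
apply: filterS (state_ai_to1 e0) => i; set e := d ^+ 2 / 4 in e0 * => hi x.
apply/ler_addgt0Pr => t t0.
pose s := Num.min t e.
have [s0 st1 se] : [/\ 0 < s, s <= t & s <= e].
  by rewrite /s lt_min !ge_min !lexx orbT t0 e0.
have [j [hj1 hj2]] := filter_ex (filterI (ai_mulr x s0) (ai_mull (I i) s0)).
pose Dij := I j - I i.
have DE : star Dij = Dij by rewrite /Dij starB !ai_self_adjoint.
have -> : x - x ** I i = (x - x ** I j) + x ** Dij.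
  by rewrite /Dij smulBr addrA subrK.
rewrite (sfunD lin) addrC (le_trans (normRD _ _))// lerD//; last first.
  by rewrite (le_trans (state_le st _))// (le_trans (ltW hj1)).
rewrite -(@ler_pXn2r _ 2)// ?nnegrE ?normR_ge0//; last first.
  by rewrite mulr_ge0 ?normR_ge0// ltW.
have := posf_CS pf (star x) Dij; rewrite starK => /le_trans; apply.
have := state_Re_bounds (star x); rewrite starK normR_star => /andP[x0 x1].
have /andP[D0 _] := state_Re_bounds Dij.
have : complex.Re (phi (star Dij ** Dij)) <= 4 * e.
  rewrite DE {1 2}/Dij smulBl !smulBr !(sfunB lin) !ReB.
  have := state_Re_bounds (I j); have := state_Re_bounds (I i).
  have := ai_norm i; have := ai_norm j.
  have := normR_ge0 (I i); have := normR_ge0 (I j).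
  rewrite !ai_self_adjoint => i0 j0 i1 j1 /andP[_ h1] /andP[_ h2].
  have : complex.Re (phi (I i ** I j)) = complex.Re (phi (I j ** I i)).
    rewrite -{1}(ai_self_adjoint i) -(ai_self_adjoint j) (posf_hermitian pf).
    by rewrite !ai_self_adjoint; case: (phi _).
  move=> ->; have := Re_le_normR (phi (I i - I j ** I i)).
  have := state_le st (I i - I j ** I i).
  rewrite (sfunB lin) ReB => h3 h4.
  have : normR (I j) ^+ 2 <= 1 by rewrite expr_le1.
  have : normR (I i) ^+ 2 <= 1 by rewrite expr_le1.
  lra.
rewrite DE in D0 * => D1.
rewrite exprMn [d ^+ 2 * _]mulrC; apply: ler_pM => //.
by rewrite (le_trans D1)// /e; lra.
Qed.

End state.
End approximate_identities.

(** * Geometric convergence and fixed points *)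

Section completeness.
Context (R : realType).

Lemma geometric_small (K q e : R) : 0 <= q < 1 -> 0 < e ->
  \forall n \near \oo, K * q ^+ n < e.
Proof.
move=> /andP[q0 q1] e0; have q1' : `|q| < 1 by rewrite ger0_norm.
have /cvgrPdist_lt/(_ e e0) := cvg_geometric K q1'.
apply: filterS => n; rewrite sub0r normrN; apply: le_lt_trans.
exact: ler_norm.
Qed.

Lemma geometric_dist (V : normedZmodType R[i]) (u : nat -> V) (K q : R) :
  0 <= q < 1 -> (forall n, normR (u n.+1 - u n) <= K * q ^+ n) ->
  forall n m, (n <= m)%N -> normR (u m - u n) <= K / (1 - q) * q ^+ n.
Proof.
move=> /andP[q0 q1] uq n m /subnKC <-; have q1' : 0 < 1 - q by lra.
have K0 : 0 <= K.
  by have := uq 0%N; rewrite expr0 mulr1; apply: le_trans; exact: normR_ge0.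
(* The exact geometric sum, kept with its last factor so that the induction closes. *)
have : normR (u (n + (m - n))%N - u n) <=
    K / (1 - q) * q ^+ n * (1 - q ^+ (m - n)).
  elim: (m - n)%N => [|k IH]; first by rewrite addn0 subrr normR0 subrr mulr0.
  rewrite addnS (le_trans (normR_dist_add _ (u (n + k)%N) _))//.
  have -> : K / (1 - q) * q ^+ n * (1 - q ^+ k.+1) =
      K * q ^+ (n + k) + K / (1 - q) * q ^+ n * (1 - q ^+ k).
    by rewrite exprS exprD; field; rewrite gt_eqF.
  exact: lerD.
move=> /le_trans; apply; rewrite ler_piMr//.
  by rewrite mulr_ge0 ?exprn_ge0// divr_ge0// ltW.
by rewrite gerBl exprn_ge0.
Qed.

Lemma geometric_complete (V : completeNormedModType R[i]) (u : nat -> V)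
    (K q : R) : 0 <= q < 1 ->
  (forall n, normR (u n.+1 - u n) <= K * q ^+ n) ->
  exists l, forall n, normR (l - u n) <= K / (1 - q) * q ^+ n.
Proof.
move=> q01 uq; have um' := geometric_dist q01 uq.
have cu : cauchy (u n @[n --> \oo]).
  apply: cauchy_exP => e e0.
  have eR : (complex.Re e)%:C = e by rewrite RRe_real// gtr0_real.
  have e0' : 0 < complex.Re e by rewrite -ltcR eR.
  have [N _ HN] := geometric_small (K / (1 - q)) q01 e0'.
  exists (u N), N => // n /= Nn; rewrite -ball_normE /= -eR -normRE ltcR.
  by rewrite normR_distC (le_lt_trans (um' _ _ Nn))//; exact: HN (leqnn N).
have : cvg (u n @[n --> \oo]) by apply: cauchy_cvg.
move=> /cvg_ex[l] /cvg_normR ul.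
exists l => n; apply/ler_addgt0Pr => e e0.
have [N _ HN] := ul _ e0.
rewrite (le_trans (normR_dist_add _ (u (maxn n N)) _))// addrC lerD//.
  by rewrite um'// leq_maxl.
by apply/ltW/HN; exact: leq_maxr.
Qed.

(** Banach's theorem on a closed set [P]. It inverts [damp], with trivial [P], and extracts square
    roots, where [P] is a ball of self-adjoint elements on which the iteration contracts. *)
Lemma contraction_fixpoint (V : completeNormedModType R[i]) (P : V -> Prop)
    (g : V -> V) (q : R) (x0 : V) : 0 <= q < 1 ->
  (forall x, P x -> P (g x)) ->
  (forall x y, P x -> P y -> normR (g x - g y) <= q * normR (x - y)) ->
  (forall l, (forall e, 0 < e -> exists2 x, P x & normR (l - x) < e) -> P l) ->
  P x0 -> exists2 x, P x & g x = x.
Proof.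
move=> q01 Pg gq Pclosed Px0; have /andP[q0 q1] := q01.
pose u n := iter n g x0.
have Pu n : P (u n) by elim: n => // n; exact: Pg.
have uq n : normR (u n.+1 - u n) <= normR (g x0 - x0) * q ^+ n.
  elim: n => [|n IH]; first by rewrite expr0 mulr1.
  rewrite (le_trans (gq _ _ (Pu n.+1) (Pu n)))// exprS mulrCA.
  exact: ler_wpM2l.
have [l ul] := geometric_complete q01 uq.
have ul' e : 0 < e -> exists n, normR (l - u n) < e /\ normR (l - u n.+1) < e.
  move=> e0; have [N _ HN] := geometric_small (normR (g x0 - x0) / (1 - q)) q01 e0.
  by exists N; split; apply: le_lt_trans (ul _) (HN _ _) => //=.
have Pl : P l.
  apply: Pclosed => e e0; have [n [ne _]] := ul' e e0.
  by exists (u n).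
exists l => //; apply/eqP; rewrite -subr_eq0; apply/eqP/normR_le0.
apply/ler_addgt0Pr => e e0; rewrite add0r.
have [n [h1 h2]] := ul' (e / 2) ltac:(lra).
rewrite (le_trans (normR_dist_add _ (u n.+1) _))//.
have h3 := gq _ _ Pl (Pu n).
have h4 : q * normR (l - u n) <= normR (l - u n) by rewrite ler_piMl ?normR_ge0// ltW.
by rewrite [normR (u _ - _)]normR_distC; lra.
Qed.

End completeness.

(** * Cohen factorization for a state *)

Section factorization.
Context (R : realType) (A : cstarAlgType R[i]).
Implicit Types (x y e : A).

Let c : R := 1 / 4.

Let subrACA x y z t : x - y - (z - t) = x - z - (y - t).
Proof. by rewrite !opprB addrACA [RHS]addrACA [- z + _]addrC. Qed.

(** Right multiplication by [3/4 + e/4] in the unitization, which is never formed. If [e] has norm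
    at most 1, this differs from the identity by at most 1/2, so its inverse has norm at most 2. *)
Definition damp e x := x - c%:C *: (x - x ** e).

Lemma dampB e x y : damp e (x - y) = damp e x - damp e y.
Proof. by rewrite /damp smulBl subrACA scalerBr subrACA. Qed.

Lemma normR_damp_diff e x : normR e <= 1 ->
  normR (c%:C *: (x - x ** e)) <= 1 / 2 * normR x.
Proof.
move=> e1; rewrite normRZ normR_real ger0_norm /c; last by lra.
have := normRD x (- (x ** e)); rewrite normRN => h.
have := normR_smul x e; have := normR_ge0 x => x0 h'.
have : normR x * normR e <= normR x by rewrite ler_piMr.
by lra.
Qed.

Lemma normR_damp e x : normR e <= 1 -> normR x <= 2 * normR (damp e x).
Proof.
move=> e1; have := normR_damp_diff x e1.
have : normR x <= normR (damp e x) + normR (c%:C *: (x - x ** e)).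
  by rewrite -{1}(subrK (c%:C *: (x - x ** e)) x) normRD.
by lra.
Qed.

Lemma damp_bij e : normR e <= 1 ->
  exists V, cancel V (damp e) /\ cancel (damp e) V.
Proof.
move=> e1; have ex x : exists y, damp e y = x.
  have half : 0 <= (1 / 2 : R) < 1 by apply/andP; split; lra.
  have [|//|y _ yE] := @contraction_fixpoint R A (fun=> True)
    (fun y => x + c%:C *: (y - y ** e)) (1 / 2) 0 half (fun _ _ => I) _ _ I.
  - move=> y z _ _; rewrite opprD addrACA subrr add0r -scalerBr.
    have -> : y - y ** e - (z - z ** e) = (y - z) - (y - z) ** e.
      by rewrite smulBl subrACA.
    exact: normR_damp_diff.
  - by exists y; rewrite /damp -{1}yE addrK.
have [V VE] := choice ex; exists V; split => // x.
apply/eqP; rewrite -subr_eq0; apply/eqP/normR_le0.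
rewrite (le_trans (normR_damp _ e1))//.
by rewrite dampB VE subrr normR0 mulr0.
Qed.

End factorization.

Section state_factorization.
Context (R : realType) (A : cstarAlgType R[i]).
Context (D : Type) (le : D -> D -> Prop) (I : D -> A).
Hypothesis ai : approximate_identity le I.
Context (phi : A -> R[i]) (st : states phi).

(* Cohen's construction: the composite of the maps damp (e_m) for m < n is right
   multiplication by b_n = (3/4)^n + al n, where the e_n are chosen so that al n
   converges and the inverses of the b_n stay bounded under phi. *)
Lemma state_factor : exists a, forall x, normR (phi x) <= 2 * normR (x ** a).
Proof.
have lin := (state_posf st).1; have FF := ai_filter ai.
pose s n : R := (3 / 4) ^+ n.
have s0 n : 0 < s n by rewrite exprn_gt0//; lra.
(* The first condition makes [al] converge geometrically; the tolerance [(1/4)^n] in the second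
   beats the growth [2^n] of the inverses of the [b n]. *)
have pick (p : nat * A) : exists i, normR (p.2 - I i ** p.2) < s p.1 /\
    forall x, normR (phi (x - x ** I i)) <= (1 / 4) ^+ p.1 * normR x.
  have d0 : 0 < (1 / 4 : R) ^+ p.1 by rewrite exprn_gt0//; lra.
  have [i [h1 h2]] := filter_ex
    (filterI (ai_mull ai p.2 (s0 p.1)) (state_ai_small ai st d0)).
  by exists i.
have [h hP] := choice pick.
pose c : R := 1 / 4.
(* The recursion is the part in [A] of [(3/4 + e_n/4) ((3/4)^n + al n)]. *)
pose fix al n : A := if n is n'.+1 then
  al n' - c%:C *: (al n' - I (h (n', al n')) ** al n') +
  (c * s n')%:C *: I (h (n', al n')) else 0.
pose e n := I (h (n, al n)).
have alS n : al n.+1 = al n - c%:C *: (al n - e n ** al n) + (c * s n)%:C *: e n by [].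
pose b n x := (s n)%:C *: x + x ** al n.
have bS n x : b n.+1 x = b n (damp (e n) x).
  rewrite /b alS /damp smulDr smulBr !smulZr smulBr.
  rewrite smulBl smulZl smulBl smulA.
  have -> : (s n)%:C *: (x - c%:C *: (x - x ** e n)) =
      (s n.+1)%:C *: x + (c * s n)%:C *: (x ** e n).
    rewrite scalerBr scalerA -rmorphM mulrC scalerBr opprB addrA addrAC.
    by rewrite -scalerBl -rmorphB; congr (_%:C *: _ + _); rewrite /s exprS /c; field.
  by rewrite -[RHS]addrA [X in _ = _ + X]addrC.
have e1 n : normR (e n) <= 1 by exact: (ai_norm ai).
(* In norm the inverses may grow like [2^n]. Under [phi], passing from [n] to [n + 1] costs at most
   [1/4 * (1/4)^n * 2 * 2^n = (1/2)^(n+1)] times [normR x], which sums to less than 2. *)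
have inv n : exists G : A -> A, forall x, [/\ G (b n x) = x,
    normR (G x) <= 2 ^+ n * normR x &
    normR (phi (G x)) <= (2 - (1 / 2) ^+ n) * normR x].
  elim: n => [|n [G GP]].
    exists id => x; split.
    - by rewrite /b /s expr0 scale1r smul0r addr0.
    - by rewrite expr0 mul1r.
    - by rewrite expr0 (_ : 2 - 1 = 1) ?mul1r ?state_le//; lra.
  have [V [V1 V2]] := damp_bij (e1 n).
  have NV x : normR (V x) <= 2 * normR x.
    by rewrite -{2}[x]V1; exact: normR_damp.
  exists (V \o G) => x /=; have [_ G2 G3] := GP x; split.
  - by rewrite bS; have [-> _ _] := GP (damp (e n) x); rewrite V2.
  - by rewrite (le_trans (NV _))// exprS -mulrA ler_wpM2l.
  - have VE : V (G x) = G x + c%:C *: (V (G x) - V (G x) ** e n).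
      by rewrite -{2}[G x]V1 /damp subrK.
    rewrite VE (sfunD lin) (sfunZ lin) (le_trans (normRD _ _))// normRM normR_real.
    have [_ /(_ (V (G x)))] := hP (n, al n); rewrite -/(e n) /= => hV.
    have cc : `|c| = 1 / 4 by rewrite ger0_norm /c//; lra.
    have q0 : 0 <= (1 / 4 : R) ^+ n by rewrite exprn_ge0//; lra.
    have : (1 / 4 : R) ^+ n * normR (V (G x)) <=
           (1 / 4) ^+ n * (2 * (2 ^+ n * normR x)).
      by rewrite ler_wpM2l// (le_trans (NV _))// ler_wpM2l.
    have -> : (1 / 4 : R) ^+ n * (2 * (2 ^+ n * normR x)) =
              2 * ((1 / 2) ^+ n * normR x).
      rewrite mulrCA; congr (_ * _); rewrite mulrA -exprMn; congr (_ ^+ _ * _).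
      by field.
    by rewrite cc exprS; lra.
have [a ha] : exists a, forall n, normR (a - al n) <= (1 / 2) / (1 - 3 / 4) * s n.
  apply: (@geometric_complete R A al) => [|n]; first by apply/andP; split; lra.
  have [] := hP (n, al n); rewrite -/(e n) /= -/(s n) => h1 _.
  rewrite -/(al n.+1) alS addrAC [_ - _ - al n]addrAC subrr add0r.
  rewrite (le_trans (normRD _ _))// normRN !normRZ !normR_real.
  have c0 : 0 <= c by rewrite /c; lra.
  have cs0 : 0 <= c * s n by rewrite mulr_ge0// ltW.
  rewrite (ger0_norm c0) (ger0_norm cs0) /c.
  have : normR (e n) * s n <= s n by rewrite ler_piMl// ltW.
  by lra.
(* Since [a] is within [2 s_N] of [al N], [b N x] is within [3 s_N |x|] of [x ** a]; recovering [x]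
   from [b N x] costs a factor 2 under [phi]. *)
exists a => x; apply/ler_addgt0Pr => t t0.
have s01 : 0 <= (3 / 4 : R) < 1 by apply/andP; split; lra.
have [N _ HN] := geometric_small (2 * (3 * normR x)) s01 t0.
have := HN N (leqnn N); rewrite -/(s N) /= => hN.
have [G0 G0P] := inv N; have [G1 _ _] := G0P x.
have [_ _] := G0P (b N x); rewrite G1 => hx.
have : normR (b N x) <= s N * normR x + (normR (x ** a) + normR x * (2 * s N)).
  rewrite (le_trans (normRD _ _))// normRZ normR_real (ger0_norm (ltW (s0 N))) lerD2l.
  rewrite -[al N](subKr a) smulBr (le_trans (normRD _ _))// lerD2l normRN.
  rewrite (le_trans (normR_smul _ _))// ler_wpM2l ?normR_ge0//.
  by have := ha N; rewrite (_ : 1 / 2 / (1 - 3 / 4) = 2 :> R)//; field.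
have : 0 <= (1 / 2 : R) ^+ N by rewrite exprn_ge0//; lra.
have := normR_ge0 (b N x) => b0 p0.
have := mulr_ge0 p0 b0.
by lra.
Qed.

End state_factorization.

(** * Limits of complex-valued functions along a filter *)

Section complex_limits.
Context (R : realType) (T : Type) (F : set_system T) (FF : ProperFilter F).
Implicit Types (g h : T -> R[i]) (l : R[i]).

Definition clim g l :=
  forall e : R, 0 < e -> \forall t \near F, normR (l - g t) < e.

Lemma clim_unique g l l' : clim g l -> clim g l' -> l = l'.
Proof.
move=> gl gl'; apply/eqP; rewrite -subr_eq0; apply/eqP/normR_le0.
apply/ler_addgt0Pr => e e0; rewrite add0r.
have e2 : 0 < e / 2 by lra.
have [t [h1 h2]] := filter_ex (filterI (gl _ e2) (gl' _ e2)).
by rewrite (le_trans (normR_dist_add _ (g t) _))// (normR_distC (g t)); lra.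
Qed.

Lemma clim_lin (c : R[i]) g h l l' : clim g l -> clim h l' ->
  clim (fun t => c * g t + h t) (c * l + l').
Proof.
move=> gl hl e e0; have c0 : 0 < 2 * (normR c + 1) by have := normR_ge0 c; lra.
apply: filterS2 (gl _ (divr_gt0 e0 c0)) (hl (e / 2) ltac:(lra)) => t h1 h2.
rewrite opprD addrACA -mulrBr (le_lt_trans (normRD _ _))// normRM.
have : normR (l - g t) * (2 * (normR c + 1)) < e by rewrite -ltr_pdivlMr.
by have := normR_ge0 (l - g t); lra.
Qed.

Lemma clim_le g l (K : R) : clim g l ->
  (\forall t \near F, normR (g t) <= K) -> normR l <= K.
Proof.
move=> gl gK; apply/ler_addgt0Pr => e e0.
have [t [h1 h2]] := filter_ex (filterI (gl _ e0) gK).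
by rewrite -(subrK (g t) l) (le_trans (normRD _ _))// addrC lerD// ltW.
Qed.

Lemma clim_cvg g l : g t @[t --> F] --> (l : (R[i] : numFieldType)^o) <-> clim g l.
Proof. exact: (@cvg_normR R (R[i] : numFieldType)^o). Qed.

End complex_limits.

(** * Strict extension of states to the multiplier algebra *)

Section multipliers.
Context (R : realType) (A : cstarAlgType R[i]).
Implicit Types (m n : multiplier A) (a x : A).

Lemma normR_lmul m a : normR (lmul m a) <= normR m * normR a.
Proof. by rewrite -lecR [X in _ <= X]rmorphM /= !normRE lmul_le. Qed.

Lemma normR_mult_of a : normR (mult_of a) <= normR a.
Proof.
rewrite -lecR !normRE; apply: mnorm_le => // b /=; exact: norm_smul_le.
Qed.

Lemma lmulB m a b : lmul m (a - b) = lmul m a - lmul m b.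
Proof. by rewrite lmul_argD -scaleN1r lmul_argZ scaleN1r. Qed.

Lemma strictly_continuous_clim (psi : multiplier A -> R[i]) (T : Type)
    (F : set_system T) (FF : ProperFilter F) (g : T -> multiplier A) m :
  strictly_continuous psi ->
  (g t : strict_multiplier A) @[t --> F] --> (m : strict_multiplier A) ->
  clim F (psi \o g) (psi m).
Proof.
move=> psic gm; apply/clim_cvg.
exact: (cvg_comp (G := nbhs (m : strict_multiplier A)) _ _ gm (psic m)).
Qed.

Section strict_extension.
Context (D : Type) (le : D -> D -> Prop) (I : D -> A).
Hypothesis ai : approximate_identity le I.

Lemma mult_of_ai_strict m :
  (mult_of (lmul m (I i)) : strict_multiplier A) @[i --> tails le] -->
  (m : strict_multiplier A).
Proof.
have FF := ai_filter ai.
apply/strict_cvgP; split=> a; apply/cvg_normR => e e0.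
  have m0 : 0 < normR m + 1 by have := normR_ge0 m; lra.
  apply: filterS (ai_mull ai a (divr_gt0 e0 m0)) => i /=.
  rewrite ltr_pdivlMr// => hi; rewrite -lmulM -lmulB.
  rewrite (le_lt_trans (normR_lmul _ _))//.
  by have := normR_ge0 (a - I i ** a); lra.
apply: filterS (ai_mulr ai (rmul m a) e0) => i /=.
by rewrite -centralP.
Qed.

(** The extension is the limit of [phi (lmul m (I i))]. Domination of [phi] by [x ** a] makes this
    net Cauchy, because [I i ** a] converges, and in the limit bounds the extension by the strict
    seminorm [2 |m a|]. *)
Lemma strict_ext_exists (phi : A -> R[i]) : states phi ->
  exists psi, [/\ states psi, strictly_continuous psi & psi \o @mult_of R A = phi].
Proof.
move=> st; have lin := (state_posf st).1; have FF := ai_filter ai.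
have [a ha] := state_factor ai st.
have ext m : exists l, clim (tails le) (fun i => phi (lmul m (I i))) l.
  apply: complex_cauchy_cvg => e e0.
  have m0 : 0 < 4 * (normR m + 1) by have := normR_ge0 m; lra.
  have d0 := divr_gt0 e0 m0.
  have [j hj] := filter_ex (ai_mull ai a d0); exists (phi (lmul m (I j))).
  apply: filterS (ai_mull ai a d0) => i hi.
  rewrite -(sfunB lin) -lmulB (le_lt_trans (ha _))// -lmulM smulBl.
  have := normR_dist_add (I j ** a) a (I i ** a).
  rewrite (normR_distC _ a) => h.
  have h' : normR (I j ** a - I i ** a) < 2 * (e / (4 * (normR m + 1))) by lra.
  have := normR_lmul m (I j ** a - I i ** a).
  set u := normR (I j ** a - I i ** a) in h' *.
  have u0 : 0 <= u by exact: normR_ge0.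
  have : u * (4 * (normR m + 1)) < 2 * e.
    by rewrite -ltr_pdivlMr// -mulrA.
  by lra.
have [psi psiP] := choice ext.
have psi_lin : scalar psi.
  move=> c m n; apply: clim_unique (psiP _) _.
  rewrite (_ : (fun i => _) = fun i => c * phi (lmul m (I i)) + phi (lmul n (I i))).
    exact: clim_lin.
  by apply/funext => i; rewrite lmulD lmulZ lin.
have psi_mult x : psi (mult_of x) = phi x.
  apply: clim_unique (psiP _) _ => e e0; apply: filterS (ai_mulr ai x e0) => i /=.
  by rewrite -(sfunB lin); apply: le_lt_trans; exact: state_le.
have psi_le m : normR (psi m) <= normR m.
  apply: clim_le (psiP m) _; apply: filterE => i.
  rewrite (le_trans (state_le st _))// (le_trans (normR_lmul _ _))//.
  by rewrite ler_piMr ?normR_ge0// (ai_norm ai).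
have psi_strict m : normR (psi m) <= 2 * normR (lmul m a).
  apply/ler_addgt0Pr => e e0; apply: clim_le (psiP m) _.
  have m0 : 0 < 2 * (normR m + 1) by have := normR_ge0 m; lra.
  apply: filterS (ai_mull ai a (divr_gt0 e0 m0)) => i.
  rewrite ltr_pdivlMr// => hi; rewrite (le_trans (ha _))// -lmulM.
  have := normR_lmul m (a - I i ** a); rewrite lmulB => h.
  have := normRD (lmul m a) (- (lmul m a - lmul m (I i ** a))).
  rewrite normRN subKr => h'; have := normR_ge0 (a - I i ** a).
  by lra.
exists psi; split; last exact/funext.
- apply: stateI.
  + split => // m; have [M ME] : exists M, M = star m ** m by exists (star m ** m).
    rewrite -ME; apply: ge0_approx => e e0.
    have M0 : 0 < 4 * (normR M + 1) by have := normR_ge0 M; lra.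
    have e4 : 0 < e / 4 by lra.
    have [i [hi1 hi2]] := filter_ex (filterI (ai_mull ai (lmul M a) e4)
                                             (ai_mull ai a (divr_gt0 e0 M0))).
    (* [I i M I i] is the square of [lmul m (I i)] in [A], where [phi] is positive, and it is close
       to [M] in the seminorm given by [a], which controls [psi]. *)
    exists (psi (mult_of (I i ** lmul M (I i)))).
      have -> : I i ** lmul M (I i) = star (lmul m (I i)) ** lmul m (I i).
        rewrite ME; transitivity (rmul (mstar m) (I i) ** lmul m (I i)).
          exact: (esym (centralP (mstar m) _ _)).
        by rewrite /= (ai_self_adjoint ai).
      by rewrite psi_mult; exact: (state_posf st).2.
    rewrite -(sfunB psi_lin) (le_trans (psi_strict _))//.
    rewrite lmulD lmulN [lmul (mult_of _) a]/= -smulA -lmulM.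
    have h1 := normR_dist_add (lmul M a) (I i ** lmul M a)
                              (I i ** lmul M (I i ** a)).
    have h2 : normR (I i ** lmul M a - I i ** lmul M (I i ** a)) <=
              normR M * normR (a - I i ** a).
      rewrite -smulBr -lmulB (le_trans (normR_smul _ _))//.
      rewrite (le_trans _ (normR_lmul _ _))// ler_piMl ?normR_ge0//.
      exact: (ai_norm ai).
    move: hi2; rewrite ltr_pdivlMr//; have := normR_ge0 (a - I i ** a).
    by rewrite /= in h1 *; lra.
  + exact: psi_le.
  + move=> e e0; have [x x1 hx] := state_attained st e0.
    exists (mult_of x); first by rewrite (le_trans (normR_mult_of _)).
    by rewrite psi_mult.
- move=> m.
  have FN : ProperFilter (nbhs (m : strict_multiplier A)) by exact: nbhs_pfilter.
  apply/clim_cvg => e e0.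
  have [cl _] := (@strict_cvgP R A (nbhs (m : strict_multiplier A)) _ m).1 cvg_id.
  have /cvg_normR/(_ (e / 2) ltac:(lra)) := cl a.
  apply: filterS => n hn; rewrite -(sfunB psi_lin).
  rewrite (le_lt_trans (psi_strict _))// lmulD lmulN; lra.
Qed.

Lemma strict_extP (phi : A -> R[i]) : states phi ->
  [/\ states (strict_ext phi), strictly_continuous (strict_ext phi) &
      strict_ext phi \o @mult_of R A = phi].
Proof. by move=> /strict_ext_exists; exact: xgetPex. Qed.

(** [strict_ext] is picked by choice; this formula is what shows that it is affine in [phi]. *)
Lemma strict_ext_clim (phi : A -> R[i]) m : states phi ->
  clim (tails le) (fun i => phi (lmul m (I i))) (strict_ext phi m).
Proof.
move=> st; have [_ sc extE] := strict_extP st.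
have /= := strictly_continuous_clim (ai_filter ai) sc (@mult_of_ai_strict m).
suff -> : strict_ext phi \o (fun i => mult_of (lmul m (I i))) =
          (fun i => phi (lmul m (I i))) by [].
by apply/funext => i; exact: (congr1 (@^~ _) extE).
Qed.

End strict_extension.
End multipliers.

(** * Contractivity of positive functionals *)

Section contractivity.
Context (R : realType) (A : cstarAlgType R[i]).
Implicit Types (a h x y z : A) (phi : A -> R[i]).

(* [y] plays the role of [1 - sqrt (1 - a)], which exists without a unit. *)
Lemma one_minus_sqrt a : self_adjoint a -> normR a <= 1 / 2 ->
  exists2 y, self_adjoint y & a = y + y - y ** y.
Proof.
move=> asa a2.
(* A fixed point of [g] below solves [a = 2 y - y^2]. On this ball squaring is 1-Lipschitz, so [g]
   has ratio 1/2, and it preserves the ball since [(1/2 + 1/4) / 2 <= 1/2]. *)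
pose P y := self_adjoint y /\ normR y <= 1 / 2.
pose g y := (1 / 2)%:C *: (a + y ** y).
have half0 : `|1 / 2 : R| = 1 / 2 by rewrite ger0_norm//; lra.
have q01 : 0 <= (1 / 2 : R) < 1 by apply/andP; split; lra.
have [| | | |y [ysa _] yE] := @contraction_fixpoint R A P g (1 / 2) 0 q01.
- move=> y [ysa y2]; split.
    by rewrite /self_adjoint /g star_realZ starD starM ysa asa.
  rewrite /g normRZ normR_real half0.
  have := normRD a (y ** y); have := normR_smul y y; have := normR_ge0 y.
  have : normR y * normR y <= 1 / 2 * (1 / 2) by rewrite ler_pM ?normR_ge0.
  by lra.
- move=> y z [_ y2] [_ z2]; rewrite /g -scalerBr normRZ normR_real half0.
  rewrite opprD addrACA subrr add0r; apply: ler_wpM2l; first by lra.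
  have -> : y ** y - z ** z = y ** (y - z) + (y - z) ** z.
    by rewrite smulBr smulBl addrA subrK.
  rewrite (le_trans (normRD _ _))//.
  have := normR_smul y (y - z); have := normR_smul (y - z) z.
  have := ler_wpM2r (normR_ge0 (y - z)) y2.
  have := ler_wpM2l (normR_ge0 (y - z)) z2.
  by lra.
- move=> l lP; split.
    apply/eqP; rewrite -subr_eq0; apply/eqP/normR_le0.
    apply/ler_addgt0Pr => e e0; have [y [ysa _] hy] := lP (e / 2) ltac:(lra).
    have := normR_dist_add (star l) y l.
    rewrite -{1}ysa -starB normR_star (normR_distC y); lra.
  apply/ler_addgt0Pr => e e0; have [y [_ y2] hy] := lP e e0.
  by have := normRD (l - y) y; rewrite subrK; lra.
- by split; [exact: star0 | rewrite normR0; lra].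
exists y => //; apply/esym/eqP; rewrite subr_eq; apply/eqP.
have -> : y + y = 2%:C *: y by rewrite rmorphMn/= scaler_nat mulr2n.
rewrite -{1}yE /g scalerA -rmorphM (_ : 2 * (1 / 2) = 1 :> R) ?scale1r//.
by field.
Qed.

(** The factor 2 pays for rescaling [z] to norm 1/2. Its size is immaterial: [posf_contractive]
    draws from it only that a supremum is finite. *)
Lemma posf_conj_le (om : A -> R[i]) x z : positive_functional om ->
  self_adjoint z -> normR z <= 1 ->
  complex.Re (om (star x ** (z ** x))) <= 2 * complex.Re (om (star x ** x)).
Proof.
move=> [lin pos] zsa z1; pose a := (1 / 2)%:C *: z.
have [||y ysa aE] := @one_minus_sqrt a.
- by rewrite /self_adjoint /a star_realZ zsa.
- by rewrite normRZ normR_real ger0_norm; lra.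
have zE : z = a + a.
  rewrite /a -scalerDl -rmorphD (_ : 1 / 2 + 1 / 2 = 1 :> R) ?scale1r//.
  by field.
suff : 0 <= complex.Re (om (star x ** x) - om (star x ** (a ** x))).
  by rewrite zE smulDl smulDr (sfunD lin) !ReB !ReD; lra.
have := pos (x - y ** x); rewrite lecE => /andP[_].
rewrite -(sfunB lin); congr (0 <= complex.Re (om _)).
rewrite starB starM ysa smulBl !smulBr aE smulBl smulDl smulBr smulDr !smulA.
by rewrite !opprB !opprD -!addrA; congr (_ + _); rewrite addrCA.
Qed.

(** The second hypothesis is Cauchy-Schwarz against a unit that [A] may lack; for a pullback it is
    supplied by the unit of the multiplier algebra. Boundedness of [om] is not presupposed. *)
Lemma posf_contractive (om : A -> R[i]) : positive_functional om ->
  (forall a, normR (om a) ^+ 2 <= complex.Re (om (star a ** a))) ->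
  forall a, normR (om a) <= normR a.
Proof.
move=> pf sqr_le; have [lin pos] := pf.
have Re0 x : 0 <= complex.Re (om (star x ** x)).
  by have := pos x; rewrite lecE => /andP[].
have Re_sqr x : complex.Re (om x) ^+ 2 <= complex.Re (om (star x ** x)).
  apply: le_trans (sqr_le x); rewrite -(real_normK (num_real (complex.Re _))).
  by rewrite lerXn2r ?nnegrE ?normR_ge0// Re_normR.
have quartic h : self_adjoint h -> normR h <= 1 ->
    complex.Re (om (h ** ((h ** h) ** h))) <= 1.
  move=> hsa h1.
  (* The set improves its own bound: with [z], also [z h^2 z] is admissible, and its value dominates
     the square of the value at [z]. *)
  pose S := [set complex.Re (om (h ** (z ** h))) | z in
              [set z : A | self_adjoint z /\ normR z <= 1]].
  have Sz z : self_adjoint z -> normR z <= 1 -> S (complex.Re (om (h ** (z ** h)))).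
    by move=> zsa z1; exists z.
  have hs : has_sup S.
    split; first by exists (complex.Re (om (h ** (0 ** h)))); apply: Sz;
      rewrite ?normR0// /self_adjoint star0.
    exists (2 * complex.Re (om (h ** h))) => _ [z [zsa z1] <-].
    by have := posf_conj_le h pf zsa z1; rewrite hsa.
  have hh1 : normR (h ** h) <= 1.
    by rewrite (le_trans (normR_smul _ _))// mulr_ile1 ?normR_ge0.
  have St : forall t, S t -> t <= sup S by move=> t; exact: sup_upper_bound.
  apply: (le_trans (St _ (Sz _ _ hh1))); first by rewrite /self_adjoint starM hsa.
  (* Each [t] in [S] satisfies [t <= (t^2 + 1) / 2] and [t^2 <= sup S]. *)
  suff : sup S <= (sup S + 1) / 2 by lra.
  apply: ge_sup; first by case: hs.
  move=> _ [z [zsa z1] <-]; set t := complex.Re _.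
  have : t ^+ 2 <= sup S.
    apply: (le_trans (Re_sqr _)).
    have -> : star (h ** (z ** h)) ** (h ** (z ** h)) =
              h ** ((z ** (h ** h) ** z) ** h).
      by rewrite !starM zsa hsa !smulA.
    apply/St/Sz; first by rewrite /self_adjoint !starM zsa hsa !smulA.
    rewrite (le_trans (normR_smul _ _))// mulr_ile1 ?normR_ge0//.
    by rewrite (le_trans (normR_smul _ _))// mulr_ile1 ?normR_ge0.
  by have := sqr_ge0 (t - 1); rewrite sqrrB expr1n mulr1; lra.
(* The bound descends from [h^4] to [h^2] and then to [h], by [Re_sqr] each time. *)
have sa_le1 h : self_adjoint h -> normR h <= 1 -> complex.Re (om h) <= 1.
  move=> hsa h1; have := quartic h hsa h1.
  have := Re_sqr (h ** h); rewrite starM hsa.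
  rewrite -(smulA h h (h ** h)) (smulA h h h) => H1 H2.
  have := Re_sqr h; rewrite hsa; set u := complex.Re (om h).
  set v := complex.Re (om (h ** h)) in H1 *.
  have := sqr_ge0 (v - 1); have := sqr_ge0 (u - 1).
  by rewrite !sqrrB !expr1n !mulr1; lra.
move=> a; have [->|a0] := eqVneq a 0; first by rewrite (sfun0 lin) !normR0.
have na0 : 0 < normR a.
  by rewrite lt_neqAle normR_ge0 andbT eq_sym; apply: contra a0 => /eqP na;
    rewrite (normR_le0 (x := a)) ?na.
pose b := (normR a)^-1%:C *: a.
have ni : `|(normR a)^-1| = (normR a)^-1 by rewrite ger0_norm ?invr_ge0 ?normR_ge0.
have b1 : normR b = 1 by rewrite normRZ normR_real ni mulVf ?gt_eqF.
have ob : normR (om b) ^+ 2 <= 1.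
  rewrite (le_trans (sqr_le _))// sa_le1//.
    by rewrite /self_adjoint starM starK.
  by rewrite normR_star_smul b1 expr1n.
have : normR (om b) <= 1 by rewrite -(@ler_pXn2r _ 2)// ?nnegrE ?normR_ge0// expr1n.
by rewrite /b (sfunZ lin) normRM normR_real ni mulrC ler_pdivrMr// mul1r.
Qed.

End contractivity.

(** * Pullbacks and convex combinations of states *)

Section pullback.
Context (R : realType) (A : cstarAlgType R[i]).

(** The constant net at the unit is an approximate identity of the multiplier algebra, so
    convergence of states to 1 applies to it. *)
Lemma state_mone (psi : multiplier A -> R[i]) : states psi -> psi (mone A) = 1.
Proof.
move=> st; have triv : directed (fun _ _ : unit => True).
  by split=> // *; exists tt.
have FF := tails_filter triv.
have ai : approximate_identity (fun _ _ : unit => True) (fun=> mone A).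
  split => //.
  - move=> _; split; last by apply: mnorm_le => // a; rewrite mul1r.
    by exists (mone A); apply: multiplier_eql => a /=; rewrite starK.
  - move=> m; rewrite (_ : mone A ** m = m); first exact: cvg_cst.
    exact: multiplier_eql.
  - move=> m; rewrite (_ : m ** mone A = m); first exact: cvg_cst.
    exact: multiplier_eql.
apply: esym; apply/eqP; rewrite -subr_eq0; apply/eqP/normR_le0/ler_addgt0Pr => e e0.
by rewrite add0r; have [i /ltW] := filter_ex (state_ai_cvg1 ai st e0).
Qed.

(** Relative properness keeps the norm from dropping below 1: [f (J i)] tends strictly to the unit,
    hence [psi (f (J i))] tends to 1. *)
Lemma state_pullback (f : A -> multiplier A) (psi : multiplier A -> R[i]) :
  relatively_proper f -> states psi -> strictly_continuous psi ->
  states (psi \o f).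
Proof.
move=> [[fl fM fS] [D [le [J [aiJ _ fJ]]]]] st sc.
have [lin pos] := state_posf st.
have pf : positive_functional (psi \o f).
  split=> [c a b|a] /=; first by rewrite fl lin.
  by rewrite fM fS.
apply: stateI => //.
  apply: posf_contractive => // a /=; rewrite fM fS.
  have := posf_CS (state_posf st) (mone A) (f a).
  have m1 (m : multiplier A) : star (mone A) ** m = m.
    by apply: multiplier_eql => b /=; rewrite starK.
  by rewrite !m1 (state_mone st) mul1r.
move=> e e0; have FF := ai_filter aiJ.
have [i hi] := filter_ex (strictly_continuous_clim FF sc fJ e0).
exists (J i); first exact: (ai_norm aiJ).
move: hi => /=; rewrite (state_mone st) => hi.
have := normRD (1 - psi (f (J i))) (psi (f (J i))); rewrite subrK.
rewrite (_ : 1 = 1%:C) // normR_real normr1 => h.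
by move: hi; rewrite (_ : 1 = 1%:C) //; lra.
Qed.

(** Different states may nearly attain their norms at unrelated elements; a late term of the
    approximate identity serves all of them at once. *)
Lemma states_convex (D : Type) (le : D -> D -> Prop) (I : D -> A)
    (k : nat) (p : 'I_k -> R) (om : 'I_k -> A -> R[i]) :
  approximate_identity le I -> prob_simplex p -> (forall i, states (om i)) ->
  states (fun a => \sum_(i < k) (p i)%:C * om i a).
Proof.
move=> ai [p01 psum] st.
have p0 i : 0 <= p i by have /andP[] := p01 i.
apply: stateI.
- split=> [c a b|a].
    rewrite mulr_sumr -big_split; apply: eq_bigr => i _ /=.
    by rewrite (state_posf (st i)).1 mulrDr mulrCA.
  by apply: sumr_ge0 => i _; rewrite mulr_ge0 ?ler0c//; exact: (state_posf (st i)).2.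
- move=> a; rewrite -[leRHS]mul1r -psum mulr_suml.
  rewrite -lecR normRE (le_trans (ler_norm_sum _ _ _))//.
  rewrite rmorph_sum; apply: ler_sum => i _.
  rewrite -normRE lecR normRM normR_real ger0_norm// ler_wpM2l//.
  exact: state_le.
- move=> e e0; have FF := ai_filter ai; have e2 : 0 < e / 2 by lra.
  have [j hj] := filter_ex (filter_forall _ (fun i => state_ai_to1 ai (st i) e2)).
  exists (I j); first exact: (ai_norm ai).
  apply: (@lt_le_trans _ _ (1 - e / 2)); first by lra.
  apply: le_trans (Re_le_normR _).
  have -> : 1 - e / 2 = \sum_(i < k) p i * (1 - e / 2).
    by rewrite -mulr_suml psum mul1r.
  have -> : complex.Re (\sum_(i < k) (p i)%:C * om i (I j)) =
            \sum_(i < k) p i * complex.Re (om i (I j)).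
    rewrite (big_morph (@complex.Re R) (@ReD R) erefl).
    by apply: eq_bigr => i _; rewrite Re_realM.
  by apply: ler_sum => i _; rewrite ler_wpM2l// ltW.
Qed.

End pullback.

(** * The metric on states and limits of geometric sequences *)

Section spectral_metric.
Context (R : realType) (A : cstarAlgType R[i]) (L : A -> \bar R).
Hypothesis hL : extended_complete_spectral_metric_space L.
Implicit Types (a b : A) (phi psi : A -> R[i]).

Lemma dist_statesP phi psi (d : R) : (dist_states L phi psi <= d%:E)%E <->
  forall b, lip_ball L b -> normR (phi b - psi b) <= d.
Proof.
split=> [h b Lb|h].
  by rewrite -lee_fin; apply: le_trans h; apply: ereal_sup_ubound; exists b.
by apply: ge_ereal_sup => _ [b Lb <-]; rewrite lee_fin; exact: h.
Qed.

Lemma lip_ball0 : lip_ball L 0.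
Proof.
have [[_ homog _] _ _ _] := hL; split; first exact: star0.
by have := homog 0 0 (star0 A); rewrite scaler0 normr0 mul0e => ->.
Qed.

Lemma dist_states_ge0 phi psi : (0 <= dist_states L phi psi)%E.
Proof.
apply: (@le_trans _ _ (normR (phi 0 - psi 0))%:E); first by rewrite lee_fin normR_ge0.
by apply: ereal_sup_ubound; exists 0 => //; exact: lip_ball0.
Qed.

Lemma dist_states_finite phi psi : (dist_states L phi psi < +oo)%E ->
  exists2 d : R, 0 <= d & (dist_states L phi psi <= d%:E)%E.
Proof.
move=> fin; exists (fine (dist_states L phi psi)).
  by rewrite fine_ge0// dist_states_ge0.
by rewrite fineK// ge0_fin_numE// dist_states_ge0.
Qed.

Lemma lip_ball_scale b (d : R) : self_adjoint b -> 0 < d -> (L b <= d%:E)%E ->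
  lip_ball L (d^-1%:C *: b).
Proof.
have [[_ homog _] _ _ _] := hL; move=> bsa d0 Lb; split.
  by rewrite /self_adjoint star_realZ bsa.
have di : 0 <= d^-1 by rewrite invr_ge0 ltW.
rewrite homog// (ger0_norm di) (@le_trans _ _ (d^-1%:E * d%:E)%E)//.
  by rewrite lee_wpmul2l.
by rewrite -EFinM mulVf// gt_eqF.
Qed.

Lemma lip_dist phi psi (d D : R) b : scalar phi -> scalar psi ->
  (dist_states L phi psi <= D%:E)%E ->
  self_adjoint b -> 0 < d -> (L b <= d%:E)%E -> normR (phi b - psi b) <= d * D.
Proof.
move=> phil psil /dist_statesP phiD bsa d0 Lb.
have := phiD _ (lip_ball_scale bsa d0 Lb).
rewrite (sfunZ phil) (sfunZ psil) -mulrBr normRM normR_real.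
have di : 0 <= d^-1 by rewrite invr_ge0 ltW.
by rewrite (ger0_norm di) mulrC ler_pdivrMr// mulrC.
Qed.

Lemma lip_dense_sa a (e : R) : self_adjoint a -> 0 < e ->
  exists c x, [/\ 0 < c, lip_ball L x & normR (a - c%:C *: x) < e].
Proof.
move=> asa e0; have [[L0 _ _] dense _ _] := hL.
have e0' : 0 < e%:C by rewrite ltcR.
have [b [[bsa Lb]]] := dense a asa _ (nbhsx_ballx a _ e0').
rewrite -ball_normE /= -normRE ltcR => ab.
have Lfin : L b \is a fin_num by rewrite ge0_fin_numE// L0.
(* Adding 1 keeps the scaling factor positive when [L b = 0]. *)
have c0 : 0 < fine (L b) + 1 by rewrite ltr_wpDl// fine_ge0// L0.
exists (fine (L b) + 1), ((fine (L b) + 1)^-1%:C *: b); split => //.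
  by apply: lip_ball_scale => //; rewrite EFinD fineK// leeDl.
by rewrite scalerA -rmorphM mulfV ?gt_eqF// scale1r.
Qed.

(** Only self-adjoint elements lie in the Lipschitz ball, so [a] is approximated through its real
    and imaginary parts. *)
Lemma lip_dense a (e : R) : 0 < e -> exists c1 c2 x1 x2,
  [/\ lip_ball L x1, lip_ball L x2 & normR (a - (c1 *: x1 + c2 *: x2)) < e].
Proof.
move=> e0; pose h := (1 / 2)%:C *: (a + star a).
pose k := (1 / 2)%:C *: ('i *: (star a - a)).
have hsa : self_adjoint h.
  by rewrite /self_adjoint /h star_realZ starD starK addrC.
have ksa : self_adjoint k.
  rewrite /self_adjoint /k star_realZ starZ starB starK.
  have -> : ('i : R[i])^*%R = - 'i by apply/eqP; rewrite eq_complex /= oppr0 !eqxx.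
  by rewrite scaleNr -scalerN opprB.
have aE : a = h + 'i *: k.
  rewrite /h /k !scalerA scalerDr scalerBr.
  have -> : 'i * (1 / 2)%:C * 'i = - (1 / 2)%:C :> R[i].
    by apply/eqP; rewrite eq_complex /=; apply/andP; split; apply/eqP; field.
  rewrite !scaleNr opprK [- _ + _]addrC addrACA subrr addr0 -scalerDl -rmorphD.
  by rewrite (_ : 1 / 2 + 1 / 2 = 1 :> R) ?scale1r//; field.
have e2 : 0 < e / 2 by lra.
have [c1 [x1 [_ Lx1 h1]]] := lip_dense_sa hsa e2.
have [c2 [x2 [_ Lx2 h2]]] := lip_dense_sa ksa e2.
exists c1%:C, ('i * c2%:C), x1, x2; split => //.
rewrite {1}aE opprD addrACA -scalerA -scalerBr (le_lt_trans (normRD _ _))//.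
have i1 : normR ('i : R[i]) = 1.
  by rewrite /normR normc_def /= expr0n add0r expr1n sqrtr1.
by rewrite normRZ i1 mul1r; lra.
Qed.

Lemma lip_separates phi psi : scalar phi -> scalar psi ->
  (forall a, normR (phi a) <= normR a) -> (forall a, normR (psi a) <= normR a) ->
  (forall e : R, 0 < e -> (dist_states L phi psi <= e%:E)%E) -> phi = psi.
Proof.
move=> phil psil phi1 psi1 d0.
have eq_ball x : lip_ball L x -> phi x = psi x.
  move=> Lx; apply/eqP; rewrite -subr_eq0; apply/eqP/normR_le0/ler_addgt0Pr => e e0.
  by rewrite add0r; exact: (dist_statesP _ _ _).1 (d0 e e0) x Lx.
apply/funext => a; apply/eqP; rewrite -subr_eq0; apply/eqP/normR_le0.
apply/ler_addgt0Pr => e e0; rewrite add0r.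
have [|c1 [c2 [x1 [x2 [Lx1 Lx2]]]]] := @lip_dense a (e / 2); first by lra.
set b := c1 *: x1 + c2 *: x2 => hb.
have phib : phi b = psi b.
  rewrite /b (sfunD phil) (sfunD psil) !(sfunZ phil) !(sfunZ psil).
  by rewrite !eq_ball.
have := phi1 (a - b); have := psi1 (a - b).
rewrite (sfunB phil) (sfunB psil) -phib => h1 h2.
have := normR_dist_add (phi a) (phi b) (psi a).
by rewrite [normR (phi b - _)]normR_distC; lra.
Qed.

Lemma cvg_dist0P (u : nat -> \bar R) : (forall n, 0 <= u n)%E ->
  (u n @[n --> \oo] --> 0%E) <->
  forall e : R, 0 < e -> \forall n \near \oo, (u n <= e%:E)%E.
Proof.
move=> u0; split=> [h e e0|h].
  have ne : nbhs (0%E : \bar R) [set y | (y < e%:E)%E].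
    by apply: open_nbhs_nbhs; split; [exact: open_ereal_lt_ereal | rewrite /= lte_fin].
  have : \forall n \near \oo, (u n < e%:E)%E by exact: (h _ ne).
  by apply: filterS => n /ltW.
apply: cvg_EFin.
  apply: filterS (h 1 ltr01) => n un; rewrite ge0_fin_numE//.
  by rewrite (le_lt_trans un)// ltry.
apply/cvgrPdist_le => e e0; apply: filterS (h e e0) => n un /=.
have unfin : u n \is a fin_num by rewrite ge0_fin_numE// (le_lt_trans un)// ltry.
by rewrite sub0r normrN ger0_norm ?fine_ge0// -lee_fin fineK.
Qed.

Lemma state_seq_limit (u : nat -> A -> R[i]) (K q : R) : 0 <= q < 1 -> 0 <= K ->
  (forall n, states (u n)) ->
  (forall n, dist_states L (u n) (u n.+1) <= (K * q ^+ n)%:E)%E ->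
  exists2 phi, states phi &
    forall n, (dist_states L (u n) phi <= (K / (1 - q) * q ^+ n)%:E)%E.
Proof.
move=> q01 K0 st ud; have /andP[q0 q1] := q01; set K' := K / (1 - q).
have K'0 : 0 <= K' by rewrite divr_ge0// subr_ge0 ltW.
have lin n := (state_posf (st n)).1.
have udist n m : (n <= m)%N -> forall x, lip_ball L x ->
    normR (u n x - u m x) <= K' * q ^+ n.
  move=> nm x Lx; rewrite normR_distC.
  apply: (@geometric_dist R _ (fun n => u n x)) => // j.
  by rewrite normR_distC; exact: (dist_statesP _ _ _).1 (ud j) x Lx.
have FF : ProperFilter (\oo : set_system nat) by exact: _.
have ex a : exists l, clim \oo (fun n => u n a) l.
  apply: complex_cauchy_cvg => e e0.
  have [|c1 [c2 [x1 [x2 [Lx1 Lx2]]]]] := @lip_dense a (e / 4); first by lra.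
  set b := c1 *: x1 + c2 *: x2 => hb.
  have e2 : 0 < e / 2 by lra.
  (* The coefficients [c1], [c2] depend on [e], so [N] comes after them. Replacing [a] by [b] costs
     [e / 4] for each of the two states, and the change at [b] is below [e / 2]. *)
  have [N _ /(_ N (leqnn N)) hN] :=
    geometric_small ((normR c1 + normR c2) * K') q01 e2.
  exists (u N a), N => // n /= Nn.
  have hbN : normR (u N b - u n b) <= (normR c1 + normR c2) * K' * q ^+ N.
    rewrite /b !(sfunD (lin _)) !(sfunZ (lin _)) opprD addrACA -!mulrBr.
    rewrite (le_trans (normRD _ _))// !normRM -mulrA mulrDl.
    by apply: lerD; apply: ler_wpM2l (normR_ge0 _) _ _ _; exact: udist.
  have := state_le (st N) (a - b); have := state_le (st n) (a - b).
  rewrite (sfunB (lin N)) (sfunB (lin n)) => h1 h2.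
  have := normR_dist_add (u N a) (u N b) (u n a).
  have := normR_dist_add (u N b) (u n b) (u n a).
  by rewrite [normR (u n b - u n a)]normR_distC /= in hN *; lra.
have [phi phiP] := choice ex.
have phil : scalar phi.
  move=> c a b; apply: clim_unique (phiP _) _.
  rewrite (_ : (fun n => _) = fun n => c * u n a + u n b); first exact: clim_lin.
  by apply/funext => n; rewrite lin.
have phid n : (dist_states L (u n) phi <= (K' * q ^+ n)%:E)%E.
  apply/dist_statesP => x Lx; apply/ler_addgt0Pr => e e0.
  have [m [nm hm]] := filter_ex (filterI (nbhs_infty_ge n) (phiP x e e0)).
  rewrite (le_trans (normR_dist_add _ (u m x) _))// lerD ?udist//.
  by rewrite normR_distC ltW.
exists phi => //; apply: stateI.
- split=> // a; apply: ge0_approx => e e0.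
  have [n hn] := filter_ex (phiP (star a ** a) e e0).
  by exists (u n (star a ** a)); [exact: (state_posf (st n)).2 | exact: ltW].
- move=> a; apply: clim_le (phiP a) _; apply: filterE => n; exact: state_le.
- move=> e e0; have [_ _ [D [le [J [aiJ LJ]]]] _] := hL.
  have FJ := ai_filter aiJ.
  have e2 : 0 < e / 2 by lra.
  (* Comparison with [u 0] alone suffices: it is within [K'] of [phi], so [L (J i) < d] bounds their
     difference at [J i] by [d K' <= e / 4]. The added 1 covers [K' = 0]. *)
  pose d := e / (4 * (K' + 1)).
  have k0 : 0 < 4 * (K' + 1) by lra.
  have d0 : 0 < d by exact: divr_gt0.
  have nd : nbhs (0%E : \bar R) [set y | (y < d%:E)%E].
    by apply: open_nbhs_nbhs; split; [exact: open_ereal_lt_ereal | rewrite /= lte_fin].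
  have Jd : \forall i \near tails le, (L (J i) < d%:E)%E by exact: (LJ _ nd).
  have [i [h1 h2]] := filter_ex (filterI (state_ai_to1 aiJ (st 0%N) e2) Jd).
  exists (J i); first exact: (ai_norm aiJ).
  have := lip_dist (lin 0%N) phil (phid 0%N) (ai_self_adjoint aiJ i) d0 (ltW h2).
  rewrite expr0 mulr1 => h3.
  have h4 : d * (4 * (K' + 1)) = e by rewrite /d mulfVK// gt_eqF.
  have := Re_le_normR (u 0%N (J i)).
  have := normRD (u 0%N (J i) - phi (J i)) (phi (J i)); rewrite subrK.
  by lra.
Qed.

End spectral_metric.

(** * The dual map as a contraction *)

Section iterated_function_system.
Context (R : realType) (A : cstarAlgType R[i]) (L : A -> \bar R).
Hypothesis hL : extended_complete_spectral_metric_space L.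
Context (k : nat) (f : 'I_k -> A -> multiplier A) (p : 'I_k -> R).
Hypotheses (hf : is_dual_ifs f) (hp : prob_simplex p).
Implicit Types (phi psi : A -> R[i]).

Lemma ifs_dual_state phi : states phi -> states (ifs_dual f p phi).
Proof.
have [_ _ [D [le [I [ai _]]]] _] := hL.
move=> st; have [est esc _] := strict_extP ai st.
apply: (states_convex (om := fun i => strict_ext phi \o f i) ai hp) => i.
exact: state_pullback.
Qed.

Lemma lip_ext_ge0 m : (0 <= lip_ext L m)%E.
Proof. by apply: le_ereal_inf_tmp => _ [C [C0 _] <-]; rewrite lee_fin ltW. Qed.

Lemma dilation_ge0 (g : A -> multiplier A) : (0 <= dilation L g)%E.
Proof.
apply: le_trans (lip_ext_ge0 (g 0)) _.
by apply: ereal_sup_ubound; exists 0 => //; exact: lip_ball0.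
Qed.

Lemma lip_extP m phi psi (d D : R) : states phi -> states psi -> 0 <= D ->
  (lip_ext L m <= d%:E)%E -> (dist_states L phi psi <= D%:E)%E ->
  normR (strict_ext phi m - strict_ext psi m) <= d * D.
Proof.
move=> st st' D0 md pD; apply/ler_addgt0Pr => e e0.
have D1 : 0 < D + 1 by lra.
(* The infimum defining [lip_ext] need not be attained; this slack in the constant costs at most [e]
   after multiplication by [D]. *)
have e1 : 0 < e / (D + 1) by exact: divr_gt0.
have : (lip_ext L m < (d + e / (D + 1))%:E)%E.
  by rewrite (le_lt_trans md)// lte_fin ltrDl.
move=> /ereal_inf_lt[_ [C [C0 hC] <-]]; rewrite lte_fin => Cd.
have : ((normR (strict_ext phi m - strict_ext psi m))%:E <= (C * D)%:E)%E.
  rewrite (le_trans (hC _ _ st st'))// EFinM lee_wpmul2l// lee_fin ltW//.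
rewrite lee_fin => /le_trans; apply.
apply: (@le_trans _ _ ((d + e / (D + 1)) * D)); first by rewrite ler_wpM2r// ltW.
rewrite mulrDl lerD2l -[leRHS](mulfVK (lt0r_neq0 D1)) ler_wpM2l//; last by lra.
exact: ltW.
Qed.

Lemma ifs_dual_contraction : (mean_dilation L f p < 1)%E ->
  exists2 q : R, 0 <= q < 1 & forall phi psi (D : R), states phi -> states psi ->
    0 <= D -> (dist_states L phi psi <= D%:E)%E ->
    (dist_states L (ifs_dual f p phi) (ifs_dual f p psi) <= (q * D)%:E)%E.
Proof.
move=> hdil; pose r i := ((p i)%:E * dilation L (f i))%E.
have p0 i : 0 <= p i by have [/(_ i)/andP[]] := hp.
have r0 i : (0 <= r i)%E by rewrite mule_ge0 ?lee_fin// dilation_ge0.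
have r1 i : (r i < 1)%E.
  apply: le_lt_trans hdil; rewrite /mean_dilation (bigD1 i)//= leeDl//.
  by apply: sume_ge0 => j _; exact: r0.
have rfin i : r i \is a fin_num.
  by rewrite ge0_fin_numE// (lt_trans (r1 i))// ltry.
have meanE : mean_dilation L f p = (\sum_(i < k) fine (r i))%:E.
  by rewrite -sumEFin; apply: eq_bigr => i _; rewrite fineK.
exists (\sum_(i < k) fine (r i)).
  rewrite -!(lte_fin, lee_fin) -meanE hdil andbT /mean_dilation.
  by apply: sume_ge0 => j _; exact: r0.
move=> phi psi D st st' D0 pD; apply/dist_statesP => b Lb.
rewrite /ifs_dual -sumrB mulr_suml -lecR normRE (le_trans (ler_norm_sum _ _ _))//.
rewrite rmorph_sum; apply: ler_sum => i _.
rewrite -mulrBr -normRE lecR normRM normR_real ger0_norm//.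
(* A map of weight 0 may have infinite dilation, on which [fine] is meaningless; a positive weight
   forces the dilation to be finite since [r i < 1]. *)
have [pi0|pi0] := eqVneq (p i) 0.
  by rewrite pi0 mul0r mulr_ge0// fine_ge0.
have dfin : dilation L (f i) \is a fin_num.
  rewrite ge0_fin_numE ?dilation_ge0// lt_neqAle leey andbT.
  have pgt0 : 0 < p i by rewrite lt_neqAle eq_sym pi0 p0.
  by apply/eqP => dy; have := r1 i; rewrite /r dy gt0_muley.
have -> : fine (r i) = p i * fine (dilation L (f i)).
  by rewrite /r fineM.
rewrite -mulrA ler_wpM2l//; apply: lip_extP => //.
by rewrite fineK//; apply: ereal_sup_ubound; exists b.
Qed.

Lemma strict_ext_convex phi psi (t : R) m : 0 <= t <= 1 ->
  states phi -> states psi ->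
  states (fun a => t%:C * phi a + (1 - t)%:C * psi a) /\
  strict_ext (fun a => t%:C * phi a + (1 - t)%:C * psi a) m =
    t%:C * strict_ext phi m + (1 - t)%:C * strict_ext psi m.
Proof.
have [_ _ [D [le [I [ai _]]]] _] := hL; have FF := ai_filter ai.
move=> /andP[t0 t1] st st'.
have stt : states (fun a => t%:C * phi a + (1 - t)%:C * psi a).
  pose w (i : 'I_2) := if i == ord0 then t else 1 - t.
  pose om (i : 'I_2) := if i == ord0 then phi else psi.
  rewrite (_ : (fun a => _) = fun a => \sum_(i < 2) (w i)%:C * om i a).
    apply: (states_convex ai) => [|i]; last by rewrite /om; case: ifP.
    split; last by rewrite big_ord_recl big_ord1 /w /= addrC subrK.
    by move=> i; rewrite /w; case: ifP => _; apply/andP; split; lra.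
  by apply/funext => a; rewrite big_ord_recl big_ord1.
split => //; apply: clim_unique (strict_ext_clim ai m stt) _.
apply: clim_lin; first exact: strict_ext_clim.
rewrite -[X in clim _ _ X]addr0 (_ : (fun i => _) =
  fun i => (1 - t)%:C * psi (lmul m (I i)) + 0); last by apply/funext => i; rewrite addr0.
apply: clim_lin; first exact: strict_ext_clim.
by move=> e e0; apply: filterE => i; rewrite subrr normR0.
Qed.

End iterated_function_system.

Theorem theorem3p9 (R : realType) (A : cstarAlgType R[i]) (L : A -> \bar R)
    (hL : extended_complete_spectral_metric_space L)
    (hLrec : lip_recovers L)
    (k : nat) (f : 'I_k -> A -> multiplier A) (hf : is_dual_ifs f)
    (p : 'I_k -> R) (hp : prob_simplex p)
    (hdil : (mean_dilation L f p < 1)%E)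
    (phi0 : A -> R[i]) (hphi0 : states phi0)
    (hfin : (dist_states L phi0 (ifs_dual f p phi0) < +oo)%E) :
  [/\ exists phi, self_similar f p phi,
      [/\ (forall M, states (iter M (ifs_dual f p) phi0)),
          (exists2 phi, states phi &
             dist_states L (iter M (ifs_dual f p) phi0) phi @[M --> \oo] --> 0%E) &
          (forall phi, states phi ->
             dist_states L (iter M (ifs_dual f p) phi0) phi @[M --> \oo] --> 0%E ->
             self_similar f p phi)],
      (forall phi phi' (t : R), 0 <= t <= 1 ->
         self_similar f p phi -> self_similar f p phi' ->
         self_similar f p (fun a => t%:C * phi a + (1 - t)%:C * phi' a)) &
      (forall phi phi', self_similar f p phi -> self_similar f p phi' ->
         (dist_states L phi phi' < +oo)%E -> phi = phi')].
Proof.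
have [q q01 contr] := ifs_dual_contraction hL hp hdil.
have /andP[q0 q1] := q01.
have Tst phi := @ifs_dual_state R A L hL k f p hf hp phi.
pose u M := iter M (ifs_dual f p) phi0.
have ust M : states (u M) by elim: M => //= M IH; exact: Tst.
have [K K0 hK] := dist_states_finite hL hfin.
have ud M : (dist_states L (u M) (u M.+1) <= (K * q ^+ M)%:E)%E.
  elim: M => [|M IH]; first by rewrite expr0 mulr1.
  rewrite exprS mulrCA; apply: (contr _ _ _ (ust M) (ust M.+1) _ IH).
  by rewrite mulr_ge0// exprn_ge0.
have d0 phi psi : (0 <= dist_states L phi psi)%E by exact: dist_states_ge0.
have [phi phist phid] := state_seq_limit hL q01 K0 ust ud.
have cvg_phi : dist_states L (u M) phi @[M --> \oo] --> 0%E.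
  apply/cvg_dist0P => // e e0.
  apply: filterS (geometric_small (K / (1 - q)) q01 e0) => M hM.
  by rewrite (le_trans (phid M))// lee_fin ltW.
have sim psi : states psi -> dist_states L (u M) psi @[M --> \oo] --> 0%E ->
    self_similar f p psi.
  move=> st /cvg_dist0P h; split => //.
  have Ts := Tst _ st.
  apply: (lip_separates hL (state_posf st).1 (state_posf Ts).1
    (state_le st) (state_le Ts)) => e e0.
  have e2 : 0 < e / 2 by lra.
  (* [u N.+1] is within [e / 2] of [psi], and, as the image of [u N], within [q * (e / 2)] of the
     image of [psi]. *)
  have [N _ hN] := h (fun M => d0 _ _) (e / 2) e2.
  have hN1 := hN N (leqnn N); have hN2 := hN N.+1 (leqnSn N).
  have h3 := contr _ _ _ (ust N) st (ltW e2) hN1.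
  apply/dist_statesP => b Lb.
  have := (dist_statesP _ _ _ _).1 hN2 b Lb.
  have := (dist_statesP _ _ _ _).1 h3 b Lb.
  have := normR_dist_add (psi b) (u N.+1 b) (ifs_dual f p psi b).
  rewrite [normR (psi b - u _ _)]normR_distC /=.
  have : q * (e / 2) <= e / 2 by rewrite ler_piMl// ltW.
  by lra.
split.
- by exists phi; exact: sim.
- by split => //; exists phi.
- move=> psi psi' t t01 [st psiE] [st' psiE'].
  have ext m := strict_ext_convex hL m t01 st st'.
  split; first by have [] := ext 0.
  apply/funext => a; rewrite {1}psiE {1}psiE' /ifs_dual !mulr_sumr -big_split /=.
  by apply: eq_bigr => i _; have [_ ->] := ext (f i a); rewrite mulrDr !(mulrCA (p i)%:C).
- move=> psi psi' [st psiE] [st' psiE'] /(dist_states_finite hL)[D D0 hD].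
  (* Both states equal their images, so any finite bound on their distance improves by the factor
     [q], again and again. *)
  have hM M : (dist_states L psi psi' <= (D * q ^+ M)%:E)%E.
    elim: M => [|M IH]; first by rewrite expr0 mulr1.
    rewrite psiE psiE' exprS mulrCA; apply: (contr _ _ _ st st' _ IH).
    by rewrite mulr_ge0// exprn_ge0.
  apply: (lip_separates hL (state_posf st).1 (state_posf st').1
    (state_le st) (state_le st')) => e e0.
  have [N _ /(_ N (leqnn N)) hN] := geometric_small D q01 e0.
  by rewrite (le_trans (hM N))// lee_fin ltW.
Qed.
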